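(* Let $m,n,r\in\mathbb{N}$, let $\boldsymbol{\alpha}_r=(\alpha_1,\dots,\alpha_r)\in n\mathcal{S}_r^\circ$ (that is, $\alpha_1,\dots,\alpha_r$ are positive real numbers with $\sum_{i=1}^r\alpha_i<n$), and put $\alpha_{r+1}=n-\sum_{i=1}^r\alpha_i>0$. Let $\boldsymbol{M}_1,\dots,\boldsymbol{M}_r$ be symmetric matrices of order $m$ satisfying $\boldsymbol{M}_i\ge 0$ for $1\le i\le r$ and $\boldsymbol{M}_{r+1}=\boldsymbol{I}_m-\sum_{i=1}^r\boldsymbol{M}_i\ge 0$. Then the function $$\mathcal{Q}(x)=\frac{\Gamma_m\bigl(xn+\frac{m+1}{2}\bigr)}{\prod_{i=1}^{r+1}\Gamma_m\bigl(x\alpha_i+\frac{m+1}{2}\bigr)}\prod_{i=1}^{r+1}|\boldsymbol{M}_i|^{x\alpha_i}$$ is logarithmically completely monotonic on $(0,\infty)$.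
   Context: $\mathbb{N}=\{1,2,\dots\}$. $\mathcal{S}_r^\circ$ is the interior of the unit simplex $\mathcal{S}_r=\{(x_1,\dots,x_r)\in[0,1]^r:\sum_{i=1}^r x_i\le 1\}$. Matrices are real; $\boldsymbol{M}\ge 0$ means that $\boldsymbol{M}$ is positive semidefinite, $\boldsymbol{I}_m$ is the $m\times m$ identity matrix, and $|\boldsymbol{M}|$ denotes the determinant of $\boldsymbol{M}$. The multivariate gamma function is $$\Gamma_m(z)=\pi^{m(m-1)/4}\prod_{j=1}^m\Gamma\Bigl(z-\frac{j-1}{2}\Bigr),\qquad \Re(z)>\frac{m-1}{2},$$ where $\Gamma$ is the classical gamma function. An infinitely differentiable and positive function $f$ is called logarithmically completely monotonic on an interval $I$ if $(-1)^k\frac{\mathrm{d}^k}{\mathrm{d}x^k}\ln f(x)\ge 0$ for all $k\in\mathbb{N}$ and all $x\in I$.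
   Formalization: Logarithmic complete monotonicity is proved when all determinants |M_i|, 1≤i≤r+1, are nonzero; if some |M_i|=0, then Q is identically 0 on (0,∞), hence not positive, and the formal theorem states Q=0 there instead. *)

(* Defs.v *)
From HB Require Import structures.
From mathcomp Require Import all_boot all_order all_algebra.
From mathcomp Require Import all_classical all_reals all_analysis.
Set Implicit Arguments.
Unset Strict Implicit.
Unset Printing Implicit Defensive.
Import Order.TTheory GRing.Theory Num.Theory.
Import numFieldNormedType.Exports.

Local Open Scope classical_set_scope.
Local Open Scope ring_scope.

(* Euler's integral. Meaningful only for 0 < z: elsewhere the integral is +oo
   and Rintegral returns the junk value 0. *)
Definition gamma (R : realType) (z : R) : R :=
  Rintegral lebesgue_measure `]0, +oo[ (fun t : R => t `^ (z - 1) * expR (- t)).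

(* Restricted to real arguments; meaningful for (m - 1) / 2 < z. The index
   j : 'I_m runs over 0, ..., m - 1, hence the shift z - j / 2 rather than
   z - (j - 1) / 2. *)
Definition multigamma (R : realType) (m : nat) (z : R) : R :=
  pi `^ (m%:R * (m%:R - 1) / 4) * \prod_(j < m) gamma (z - j%:R / 2).

Definition psdmx (R : realType) (m : nat) (A : 'M[R]_m) : Prop :=
  A^T = A /\ forall v : 'cV[R]_m, 0 <= (v^T *m A *m v) 0 0.

(* Derivatives are two-sided, so I is meant to be an open interval; the values
   of f outside I are then irrelevant. *)
Definition logarithmically_completely_monotonic
    (R : realType) (I : set R) (f : R -> R) : Prop :=
  [/\ forall (k : nat) (x : R), I x -> derivable (derive1n k f) x 1,
      forall x : R, I x -> 0 < f x
    & forall (k : nat) (x : R), (0 < k)%N -> I x ->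
        0 <= (-1) ^+ k * derive1n k (fun y => ln (f y)) x].

(* (f_1, ..., f_r, z) *)
Definition snoc (T : Type) (r : nat) (f : 'I_r -> T) (z : T) : 'I_r.+1 -> T :=
  fun i => oapp f z (unlift ord_max i).

(* Here p stands for r + 1, and a and M are the full families
   (a_1, ..., a_(r+1)) and (M_1, ..., M_(r+1)). In powR, 0 `^ y = 0 for y != 0. *)
Definition Qfun (R : realType) (m n p : nat) (a : 'I_p -> R)
    (M : 'I_p -> 'M[R]_m) (x : R) : R :=
  multigamma m (x * n%:R + m.+1%:R / 2)
    / (\prod_(i < p) multigamma m (x * a i + m.+1%:R / 2))
    * \prod_(i < p) (\det (M i)) `^ (x * a i).

(* Main.v *)
(* Writing g = ln gamma, c_j = (m + 1 - j) / 2 >= 1 for 0 <= j < m, and a_i for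
   the weights, (-1)^k times the k-th derivative of ln Q at x is, up to the
   linear terms in x (which matter only for k = 1),
     sum_j [h_j(n) n - sum_i h_j(a_i) a_i],
     h_j(a) = (-1)^k a^(k - 1) g^(k)(x a + c_j).
   Since sum_i a_i = n, it suffices that h_j is nondecreasing on ]0, n]; for
   k = 1 it is h_j(a) + ln a that is nondecreasing. The derivatives of g are
   the limits of those of Gauss' approximations
     z ln (N + 1) - sum_(j < N) ln (z + j),
   for which monotonicity up to O(1 / N) follows from a telescoping bound.
   For k = 1 the logarithms that remain are controlled by the inequality
   det A <= exp (tr A - m) for A >= 0, applied to (n / a_i) M_i. *)
Require Import Defs.
From mathcomp Require Import all_boot all_order all_algebra.
From mathcomp Require Import all_classical all_reals all_analysis.
From mathcomp Require Import measurable_realfun ring lra.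
Import Order.TTheory GRing.Theory Num.Theory.
Import numFieldNormedType.Exports.
Local Open Scope classical_set_scope.
Local Open Scope ring_scope.
Set Implicit Arguments.
Unset Strict Implicit.
Unset Printing Implicit Defensive.

(** * Euler's integral *)

(** Single terms of the sums behind h_j need not be nondecreasing in the scale. Only the full sum
    over the Gauss factors has a controlled sign, and at finite N a boundary term of the telescoping
    remains, so an error of order 1 / N has to be carried to the limit. For k = 1 monotonicity fails
    outright: g' grows like a logarithm, so - g'(x a + c) decreases in a, and [ln a] is there to
    compensate. Gauss' approximations keep differentiation away from the integral sign: Euler's
    integral supplies only positivity, the functional equation and the concavity estimate of the
    Bohr-Mollerup argument. All arguments stay at or above 1, where the integrand is continuous up
    to 0. Derivatives pass to the limit because second derivatives are bounded uniformly in N on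
    every ]b, +oo[ with b > 1. *)

Definition gamma_integrand (R : realType) (z t : R) : R := t `^ (z - 1) * expR (- t).
Arguments gamma_integrand : simpl never.

Lemma derivable_continuous (R : realType) (f : R -> R) (x : R) :
  derivable f x 1 -> f t @[t --> x] --> f x.
Proof. by move=> /derivable1_diffP/differentiable_continuous. Qed.

Lemma cvg_powR_at_right0 (R : realType) (p : R) :
  0 <= p -> t `^ p @[t --> (0 : R)^'+] --> (0 : R) `^ p.
Proof.
rewrite le_eqVlt => /predU1P[<-|p0].
  under eq_cvg do rewrite powRr0.
  by rewrite powRr0; exact: cvg_cst.
by rewrite powR0 ?gt_eqF//; exact: powR_cvg0.
Qed.

Lemma cvg_expRN (R : realType) (t : R) : expR (- s) @[s --> t] --> expR (- t).
Proof. by apply: continuous_comp; [exact: opp_continuous|exact: continuous_expR]. Qed.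

Lemma gamma_integrand_continuous (R : realType) (z : R) :
  1 <= z -> {within `[0, +oo[, continuous (gamma_integrand z)}.
Proof.
move=> z1; apply/continuous_within_itvcyP; split.
  move=> t; rewrite in_itv/= andbT => t0.
  apply: cvgM; last exact: cvg_expRN.
  by apply: derivable_continuous; case: (is_derive1_powR (z - 1) t0).
apply: cvgM.
  by apply: cvg_powR_at_right0; rewrite subr_ge0.
by apply: cvg_at_right_filter; exact: cvg_expRN.
Qed.

Lemma gamma_integrand_ge0 (R : realType) (z t : R) : 0 <= gamma_integrand z t.
Proof. by rewrite mulr_ge0 ?powR_ge0 ?expR_ge0. Qed.

Lemma gamma_integrandS (R : realType) (z t : R) :
  1 <= z -> 0 <= t -> gamma_integrand (z + 1) t = t * gamma_integrand z t.
Proof.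
move=> z1 t0; rewrite /gamma_integrand addrK.
by rewrite mulrA mulr_powRB1// (lt_le_trans _ z1).
Qed.

(** For t >= 1 and an integer n >= z - 1, the exponential series gives e^t >= t^(n + 1) / (n + 1)!,
    which bounds the integrand by (n + 1)! / t. *)
Lemma gamma_integrand_cvgy (R : realType) (z : R) :
  gamma_integrand z t @[t --> +oo] --> 0.
Proof.
have [n zn] : exists n : nat, z - 1 <= n%:R.
  by exists (Num.bound `|z - 1|); rewrite (le_trans (ler_norm _))// ltW// archi_boundP.
apply: (@squeeze_cvgr _ _ _ _ (fun=> 0) (fun t => n.+1`!%:R * t^-1)).
- near=> t.
  have t1 : 1 <= t by near: t; exact: nbhs_pinfty_ge.
  have t0 : 0 < t by rewrite (lt_le_trans _ t1).
  rewrite gamma_integrand_ge0/= /gamma_integrand expRN.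
  rewrite ler_pdivrMr ?expR_gt0//.
  have := expR_ge1Dxn n (ltW t0); set e := expR t => he.
  apply: (@le_trans _ _ (t ^+ n)).
    by rewrite -powR_mulrn ?(ltW t0)//; exact: ler_powR.
  have f0 : (0 : R) < n.+1`!%:R by rewrite ltr0n fact_gt0.
  have : t ^+ n.+1 / n.+1`!%:R <= e by rewrite (le_trans _ he)// lerDr.
  rewrite ler_pdivrMr// exprS => h.
  by rewrite mulrAC ler_pdivlMr// mulrC [X in _ <= X]mulrC.
- exact: cvg_cst.
- rewrite -(mulr0 n.+1`!%:R); apply: cvgMr.
  by apply/gtr0_cvgV0; [near=> t; near: t; exact: nbhs_pinfty_gt | exact: cvg_id].
Unshelve. all: by end_near. Qed.

(** On the positive half-line the derivative is the integrand at [z + 1] minus [z] times the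
    integrand at [z]; its integral therefore measures the defect in the functional equation. *)
Lemma is_derive_gamma_primitive (R : realType) (z t : R) : 0 < t ->
  is_derive t 1 (fun s => - gamma_integrand (z + 1) s) ((t - z) * gamma_integrand z t).
Proof.
move=> t0; have tz : t `^ z = t * t `^ (z - 1).
  by rewrite -{2}(powRr1 (ltW t0)) -powRD ?(gt_eqF t0) ?implybT// addrCA subrr addr0.
have d1 : is_derive t 1 (fun s : R => s `^ (z + 1 - 1)) (z * t `^ (z - 1)).
  by rewrite addrK; exact: is_derive1_powR.
have d2 : is_derive t 1 (fun s : R => expR (- s)) (- expR (- t)).
  by apply: is_derive_eq; rewrite mulrN1.
rewrite /gamma_integrand; apply: is_derive_eq.
rewrite !scalerN /GRing.scale/= addrK tz; ring.
Qed.

Lemma gamma_primitive_cvg0 (R : realType) (z : R) : 1 <= z ->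
  - gamma_integrand (z + 1) t @[t --> 0^'+] --> - gamma_integrand (z + 1) 0.
Proof.
move=> z1; have : 1 <= z + 1 by rewrite (le_trans z1)// lerDl.
by move=> /gamma_integrand_continuous/continuous_within_itvcyP[_ ?]; exact: cvgN.
Qed.

Lemma continuous_subspace_itv (R : realType) (f : R -> R) (a : R) (i : interval R) :
  {within `[a, +oo[, continuous f} -> [set` i] `<=` `[a, +oo[ ->
  {within [set` i], continuous f}.
Proof. by move=> cf sub; exact: continuous_subspaceW sub cf. Qed.

Lemma gamma_primitive_deriv_continuous (R : realType) (z : R) : 1 <= z ->
  {within `[0, +oo[, continuous (fun t => (t - z) * gamma_integrand z t)}.
Proof.
move=> z1; move=> t; apply: cvgM; last exact: gamma_integrand_continuous.
apply: (@continuous_subspaceT _ _ _ (fun s : R => s - z)) => s.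
by apply: cvgB; [exact: cvg_id | exact: cvg_cst].
Qed.

(* The primitive - t^z e^-t vanishes at 0 and at +oo, and its derivative
   (t - z) t^(z - 1) e^-t changes sign only at z. *)
Lemma integral_gamma_primitive_deriv_tail (R : realType) (z : R) : 1 <= z ->
  (\int[lebesgue_measure]_(t in `[z, +oo[) ((t - z) * gamma_integrand z t)%:E
   = (gamma_integrand (z + 1) z)%:E)%E.
Proof.
move=> z1; have z0 : 0 < z by rewrite (lt_le_trans _ z1).
have dF (t : R) : z < t -> is_derive t 1 (fun s => - gamma_integrand (z + 1) s)
    ((t - z) * gamma_integrand z t).
  by move=> zt; apply: is_derive_gamma_primitive; rewrite (lt_trans z0).
rewrite (@ge0_continuous_FTC2y _ _ (fun s => - gamma_integrand (z + 1) s) z 0).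
- by rewrite -EFinB sub0r opprK.
- by move=> t zt; rewrite mulr_ge0 ?subr_ge0// gamma_integrand_ge0.
- apply: continuous_subspace_itv (gamma_primitive_deriv_continuous z1) _.
  by move=> t/=; rewrite !in_itv/= !andbT; exact: le_trans (ltW z0).
- by rewrite -oppr0; apply: cvgN; exact: gamma_integrand_cvgy.
- by move=> t /dF[].
- apply: cvg_at_right_filter.
  by apply: derivable_continuous; case: (@is_derive_gamma_primitive R z z z0).
- by move=> t; rewrite in_itv/= andbT => /dF d; rewrite derive1E; case: d.
Qed.

Lemma integral_gamma_primitive_deriv_head (R : realType) (z : R) : 1 <= z ->
  (\int[lebesgue_measure]_(t in `[0%R, z]) ((t - z) * gamma_integrand z t)%:E
   = (- gamma_integrand (z + 1) z)%:E)%E.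
Proof.
move=> z1; have z0 : 0 < z by rewrite (lt_le_trans _ z1).
have dF (t : R) : 0 < t -> is_derive t 1 (fun s => - gamma_integrand (z + 1) s)
    ((t - z) * gamma_integrand z t).
  exact: is_derive_gamma_primitive.
rewrite (@continuous_FTC2 _ _ (fun s => - gamma_integrand (z + 1) s) 0 z)//.
- rewrite -EFinB /gamma_integrand (@powR0 _ (z + 1 - 1)) ?addrK ?gt_eqF//.
  by rewrite mul0r oppr0 subr0.
- apply: continuous_subspace_itv (gamma_primitive_deriv_continuous z1) _.
  by move=> t/=; rewrite !in_itv/= !andbT => /andP[].
- split.
  + by move=> t; rewrite in_itv/= => /andP[/dF[]].
  + exact: gamma_primitive_cvg0.
  + apply: cvg_at_left_filter.
    by apply: derivable_continuous; case: (dF z z0).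
- by move=> t; rewrite in_itv/= => /andP[/dF d _]; rewrite derive1E; case: d.
Qed.

Lemma measurable_itv_within_continuous (R : realType) (f : R -> R) (a : R) (i : interval R) :
  {within `[a, +oo[, continuous f} -> [set` i] `<=` `[a, +oo[ ->
  measurable_fun ([set` i] : set R) f.
Proof.
move=> cf sub; apply: subspace_continuous_measurable_fun => //.
exact: continuous_subspaceW sub cf.
Qed.

Lemma gamma_primitive_deriv_tail_integrable (R : realType) (z : R) : 1 <= z ->
  (@lebesgue_measure R).-integrable `[z, +oo[
    (fun t => ((t - z) * gamma_integrand z t)%:E).
Proof.
move=> z1; have z0 : 0 < z by rewrite (lt_le_trans _ z1).
apply/integrableP; split.
  apply/measurable_EFinP.
  apply: measurable_itv_within_continuous (gamma_primitive_deriv_continuous z1) _.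
  by move=> t/=; rewrite !in_itv/= !andbT; exact: le_trans (ltW z0).
suff -> : (\int[lebesgue_measure]_(t in `[z, +oo[) `|((t - z) * gamma_integrand z t)%:E|
    = \int[lebesgue_measure]_(t in `[z, +oo[) ((t - z) * gamma_integrand z t)%:E)%E.
  by rewrite integral_gamma_primitive_deriv_tail// ltry.
apply: eq_integral => t; rewrite inE/= in_itv/= andbT => zt.
by rewrite /= ger0_norm// mulr_ge0 ?subr_ge0 ?gamma_integrand_ge0.
Qed.

Lemma itvcy_setU (R : realType) (b : R) : 0 <= b ->
  `[0, +oo[%classic = `[0, b] `|` `]b, +oo[%classic :> set R.
Proof.
move=> b0; apply/seteqP; split=> t/=; rewrite !in_itv/= !andbT.
  by move=> t0; have [tb|bt] := leP t b; [left; rewrite t0|right].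
by move=> [/andP[]//|/ltW]; exact: le_trans.
Qed.

Lemma itv_tail_disjoint (R : realType) (b : R) :
  [disjoint `[0, b]%classic & `]b, +oo[%classic].
Proof.
apply/disj_setPS => t/=; rewrite !in_itv/= andbT => -[/andP[_ tb] bt].
by move: (lt_le_trans bt tb); rewrite ltxx.
Qed.

Lemma integrable_head_tail (R : realType) (f : R -> R) (b : R) : 0 <= b ->
  {within `[0, +oo[, continuous f} ->
  (@lebesgue_measure R).-integrable `]b, +oo[ (EFin \o f) ->
  (@lebesgue_measure R).-integrable `[0, +oo[ (EFin \o f).
Proof.
move=> b0 cf tail; rewrite (itvcy_setU b0).
have mf : measurable_fun (`[0, b] `|` `]b, +oo[) f.
  by rewrite -itvcy_setU//; exact: measurable_itv_within_continuous cf _.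
have head : (@lebesgue_measure R).-integrable `[0, b] (EFin \o f).
  apply: continuous_compact_integrable; first exact: segment_compact.
  by apply: continuous_subspace_itv cf _ => t/=; rewrite !in_itv/= andbT => /andP[].
move/integrableP: head => [_ head]; move/integrableP: tail => [_ tail].
apply/integrableP; split; first exact/measurable_EFinP.
rewrite ge0_integral_setU//.
- by rewrite lte_add_pinfty.
- by apply: measurableT_comp => //; exact/measurable_EFinP.
- exact: itv_tail_disjoint.
Qed.

(** Beyond [z + 1] the factor [t - z] is at least 1, so the derivative of the primitive, already
    known to be integrable there, dominates the integrand. *)
Lemma gamma_integrable_cy (R : realType) (z : R) : 1 <= z ->
  (@lebesgue_measure R).-integrable `[0, +oo[ (EFin \o gamma_integrand z).
Proof.
move=> z1; have z0 : 0 < z by rewrite (lt_le_trans _ z1).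
have sub (a : R) : z <= a -> `]a, +oo[ `<=` `[0, +oo[.
  by move=> za t/=; rewrite !in_itv/= !andbT => /ltW/(le_trans za)/(le_trans (ltW z0)).
apply: (@integrable_head_tail _ _ (z + 1)); first by rewrite addr_ge0// ltW.
  exact: gamma_integrand_continuous.
apply: (@le_integrable _ _ _ (@lebesgue_measure R) _ _ _
  (fun t : R => ((t - z) * gamma_integrand z t)%:E)) => //.
- apply/measurable_EFinP.
  apply: measurable_itv_within_continuous (gamma_integrand_continuous z1) _.
  by apply: sub; rewrite lerDl.
- move=> t/=; rewrite in_itv/= andbT => zt.
  rewrite lee_fin [leRHS]normrM; apply: ler_peMl => //.
  by rewrite ger0_norm; lra.
- apply: integrableS (gamma_primitive_deriv_tail_integrable z1) => //.
  by move=> t/=; rewrite !in_itv/= !andbT => h; lra.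
Qed.

Lemma subset_itvoy_itvcy (R : realType) (a : R) : `]a, +oo[ `<=` `[a, +oo[.
Proof. by move=> t/=; rewrite !in_itv/= !andbT => /ltW. Qed.

Lemma gamma_integrable (R : realType) (z : R) : 1 <= z ->
  (@lebesgue_measure R).-integrable `]0, +oo[ (EFin \o gamma_integrand z).
Proof.
move=> z1; apply: integrableS (gamma_integrable_cy z1) => //.
exact: subset_itvoy_itvcy.
Qed.

Lemma gammaE (R : realType) (z : R) : 1 <= z ->
  gamma z = Rintegral lebesgue_measure `[0, +oo[ (gamma_integrand z).
Proof.
by move=> z1; rewrite -(Rintegral_itv_obnd_cbnd (gamma_integrable z1)).
Qed.

(** The difference of the two sides is the integral of (t - z) t^(z - 1) e^-t. Cut at [z], where the
    sign changes, it splits into a head and a tail with opposite values. *)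
Lemma gammaS (R : realType) (z : R) : 1 <= z -> gamma (z + 1) = z * gamma z.
Proof.
move=> z1; have z0 : 0 < z by rewrite (lt_le_trans _ z1).
have z2 : 1 <= z + 1 by rewrite (le_trans z1)// lerDl.
apply/eqP; rewrite -subr_eq0 !gammaE// -RintegralZl//; last exact: gamma_integrable_cy.
have zi : (@lebesgue_measure R).-integrable `[0, +oo[
    (EFin \o (fun t => z * gamma_integrand z t)).
  exact: (integrableZl _ z (gamma_integrable_cy z1)).
rewrite -RintegralB//; last exact: gamma_integrable_cy.
apply/eqP.
transitivity (Rintegral (@lebesgue_measure R) `[0, +oo[
    (fun t : R => (t - z) * gamma_integrand z t)).
  apply: eq_Rintegral => t; rewrite inE/= in_itv/= andbT => t0.
  by rewrite -/(gamma_integrand (z + 1) t) -/(gamma_integrand z t) gamma_integrandS// mulrBl.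
have zc := gamma_primitive_deriv_continuous z1.
have ti : (@lebesgue_measure R).-integrable `]z, +oo[
    (EFin \o (fun t => (t - z) * gamma_integrand z t)).
  by apply: integrableS (gamma_primitive_deriv_tail_integrable z1) => //;
    exact: subset_itvoy_itvcy.
have := integrable_head_tail (ltW z0) zc ti; rewrite (itvcy_setU (ltW z0)) => ui.
rewrite Rintegral_setU//; last exact: itv_tail_disjoint.
rewrite (Rintegral_itv_obnd_cbnd ti) /Rintegral.
rewrite integral_gamma_primitive_deriv_head// integral_gamma_primitive_deriv_tail//.
by rewrite /= addNr.
Qed.

(** * Concavity estimate and positivity of the gamma function *)

Lemma ln_tangent (R : realType) (y u : R) : 0 < y -> 0 < u ->
  ln u <= ln y + (u - y) / y.
Proof.
move=> y0 u0; have uy0 : 0 < u / y by rewrite divr_gt0.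
have := @le_ln1Dx R (u / y - 1); rewrite (addrC 1) subrK ln_div ?posrE// => h.
have -> : (u - y) / y = u / y - 1 by field; rewrite gt_eqF.
by have := h ltac:(lra); lra.
Qed.

(** Weighted arithmetic-geometric inequality for u and 1: the tangent of [ln] at their mean [y] is
    evaluated at both points with weights s and 1 - s, and the linear terms cancel. *)
Lemma powR_le_affine (R : realType) (u s : R) : 0 < u -> 0 <= s <= 1 ->
  u `^ s <= 1 + s * (u - 1).
Proof.
move=> u0 /andP[s0 s1]; set y := 1 + s * (u - 1).
have su0 : 0 <= s * u by rewrite mulr_ge0// ltW.
have y0 : 0 < y.
  have [s1'|s1'] := ltP s 1; first by rewrite /y; lra.
  have -> : y = u by rewrite /y (_ : s = 1); [ring | apply/eqP; rewrite eq_le s1].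
  by [].
rewrite -[leRHS]lnK ?posrE// /powR gt_eqF// ler_expR.
have h1 := ler_wpM2l s0 (ln_tangent y0 u0).
have s1' : 0 <= 1 - s by rewrite subr_ge0.
have h2 := ler_wpM2l s1' (ln_tangent y0 ltr01); rewrite ln1 mulr0 in h2.
have e : s * ((u - y) / y) + (1 - s) * ((1 - y) / y) = 0.
  by rewrite !mulrA -mulrDl /y; apply/eqP; rewrite mulf_eq0; apply/orP; left; apply/eqP; ring.
by move: h1 h2 e; rewrite !mulrDr; set a := _ / _; set b := _ / _; nra.
Qed.

(* By concavity of s |-> t^s, t^s <= z^s (1 - s + s t / z); integrate against
   t^(z - 1) e^-t and use the functional equation. *)
Lemma gammaD_le (R : realType) (z s : R) : 1 <= z -> 0 <= s <= 1 ->
  gamma (z + s) <= z `^ s * gamma z.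
Proof.
move=> z1 /andP[s0 s1]; have z0 : 0 < z by rewrite (lt_le_trans _ z1).
have zs1 : 1 <= z + s by rewrite (le_trans z1)// lerDl.
have z2 : 1 <= z + 1 by rewrite (le_trans z1)// lerDl.
set A := z `^ s.
have i1 : (@lebesgue_measure R).-integrable `[0, +oo[
    (EFin \o (fun t => A * (1 - s) * gamma_integrand z t)).
  exact: (integrableZl _ _ (gamma_integrable_cy z1)).
have i2 : (@lebesgue_measure R).-integrable `[0, +oo[
    (EFin \o (fun t => A * (s / z) * gamma_integrand (z + 1) t)).
  exact: (integrableZl _ _ (gamma_integrable_cy z2)).
have -> : A * gamma z = A * (1 - s) * gamma z + A * (s / z) * gamma (z + 1).
  by rewrite gammaS//; field; rewrite gt_eqF.
rewrite !gammaE// -RintegralZl//; last exact: gamma_integrable_cy.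
rewrite -RintegralZl//; last exact: gamma_integrable_cy.
rewrite -RintegralD//.
apply: le_Rintegral => //.
- exact: gamma_integrable_cy.
- exact: (integrableD _ i1 i2).
move=> t/=; rewrite in_itv/= andbT => t0.
rewrite -!/(gamma_integrand _ t) gamma_integrandS//.
have -> : A * (1 - s) * gamma_integrand z t + A * (s / z) * (t * gamma_integrand z t)
  = A * (1 + s * (t / z - 1)) * gamma_integrand z t by ring.
have e0 := expR_ge0 (- t).
(* At 0 the power does not split over a sum of exponents, since 0 to the power 0 is 1. If s = 0 the
   two sides agree; otherwise z + s - 1 > 0 and the left side is 0. *)
have [->|tn0] := eqVneq t 0.
  have [es|sn0] := eqVneq s 0.
    by rewrite /A es powRr0 addr0 mul0r addr0 !mul1r.
  rewrite /gamma_integrand powR0; last by lra.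
  rewrite mul0r mulr_ge0// ?mulr_ge0 ?powR_ge0//; lra.
have tp : 0 < t by rewrite lt_neqAle eq_sym tn0.
have -> : gamma_integrand (z + s) t = t `^ s * gamma_integrand z t.
  rewrite /gamma_integrand mulrA -powRD ?tn0 ?implybT//; congr (_ `^ _ * _); ring.
rewrite ler_wpM2r ?gamma_integrand_ge0//.
have -> : t `^ s = A * (t / z) `^ s.
  by rewrite -powRM ?divr_ge0 ?ltW// mulrC mulfVK// gt_eqF.
rewrite ler_wpM2l ?powR_ge0//.
have := @powR_le_affine _ (t / z) s; apply; first by rewrite divr_gt0.
by rewrite s0.
Qed.

(** On [1, 2], an interval of length 1, the integrand is at least e^-2. *)
Lemma gamma_gt0 (R : realType) (z : R) : 1 <= z -> 0 < gamma z.
Proof.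
move=> z1; have z0 : 0 < z by rewrite (lt_le_trans _ z1).
rewrite gammaE//.
have c12 : (@lebesgue_measure R).-integrable `[1%R, 2] (EFin \o cst (expR (- 2))).
  apply: continuous_compact_integrable; first exact: segment_compact.
  by apply: continuous_subspaceT => t; exact: cvg_cst.
have sub : `[(1 : R), 2] `<=` `[(0 : R), +oo[.
  by move=> t/=; rewrite !in_itv/= andbT => /andP[t1 _]; lra.
have f12 : (@lebesgue_measure R).-integrable `[1%R, 2] (EFin \o gamma_integrand z).
  exact: integrableS (gamma_integrable_cy z1).
apply: (@lt_le_trans _ _ (Rintegral lebesgue_measure `[1%R, 2] (gamma_integrand z))).
  apply: (@lt_le_trans _ _ (Rintegral lebesgue_measure `[1%R, 2] (cst (expR (- 2 : R))))).
    have m12 : lebesgue_measure `[(1 : R), 2] = 1%:E.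
      by rewrite lebesgue_measure_itv/= lte_fin ltr1n -EFinB; congr EFin; ring.
    have c12E := @Rintegral_cst _ _ _ (@lebesgue_measure R) `[(1 : R), 2]%classic
      (measurable_itv _) (expR (- 2)).
    have f0 : 0 < fine (lebesgue_measure `[(1 : R), 2]) by rewrite m12.
    by rewrite [ltRHS]c12E; exact: (mulr_gt0 (expR_gt0 _) f0).
  apply: le_Rintegral => // t/=; rewrite in_itv/= => /andP[t1 t2].
  rewrite -[leLHS]mul1r ler_pM ?expR_ge0//; last by rewrite ler_expR lerN2.
  have p1 : 0 <= z - 1 by rewrite subr_ge0.
  by have := ler_powR t1 p1; rewrite powRr0.
rewrite /Rintegral fine_le//.
- exact: integrable_fin_num.
- by apply: integrable_fin_num => //; exact: gamma_integrable_cy.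
- apply: ge0_subset_integral => //.
    by case/integrableP: (gamma_integrable_cy z1).
  by move=> t _; rewrite lee_fin gamma_integrand_ge0.
Qed.

(** * Determinants of positive semidefinite matrices *)

Lemma psdmx_scale (R : realType) (m : nat) (c : R) (A : 'M[R]_m) :
  0 <= c -> psdmx A -> psdmx (c *: A).
Proof.
move=> c0 [sA pA]; split; first by rewrite linearZ/= sA.
by move=> v; rewrite -scalemxAr -scalemxAl mxE mulr_ge0.
Qed.

Lemma quad_block (R : realType) (m : nat) (A : 'M[R]_(1 + m)) (s : R) (w : 'cV[R]_m) :
  A^T = A ->
  ((col_mx s%:M w)^T *m A *m col_mx s%:M w) 0 0 =
  s ^+ 2 * ulsubmx A 0 0 + 2 * s * (ursubmx A *m w) 0 0 + (w^T *m drsubmx A *m w) 0 0.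
Proof.
move=> sA; have dlE : dlsubmx A = (ursubmx A)^T by rewrite -{1}sA -trmx_ursub.
rewrite -{1}[A]submxK dlE; set a := ulsubmx A; set b := ursubmx A; set D := drsubmx A.
rewrite tr_col_mx mul_row_block mul_row_col !mulmxDl tr_scalar_mx.
rewrite !mul_scalar_mx -!scalemxAl !mul_mx_scalar.
have -> : w^T *m b^T = (b *m w)^T by rewrite trmx_mul.
move: (b *m w) (w^T *m D *m w) => p q.
by rewrite !mxE; ring.
Qed.

(** For fixed [v] the quadratic form is a parabola in the first coordinate; its minimum, at - a^-1 b
    v with b the rest of the first row, is the value of the Schur complement at [v]. The determinant
    comes from one step of block elimination. *)
Lemma psdmx_schur (R : realType) (m : nat) (A : 'M[R]_(1 + m)) (a := ulsubmx A 0 0) :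
  psdmx A -> 0 < a ->
  psdmx (drsubmx A - a^-1 *: ((ursubmx A)^T *m ursubmx A)) /\
  \det A = a * \det (drsubmx A - a^-1 *: ((ursubmx A)^T *m ursubmx A)).
Proof.
move=> [sA pA] a0; have dlE : dlsubmx A = (ursubmx A)^T by rewrite -{1}sA -trmx_ursub.
have sD : (drsubmx A)^T = drsubmx A by rewrite -[in RHS]sA -trmx_drsub.
set S := _ - _; split.
  split; first by rewrite /S linearB/= linearZ/= trmx_mul trmxK sD.
  move=> v; have := pA (col_mx (- (a^-1 * (ursubmx A *m v) 0 0))%:M v).
  rewrite quad_block// -/a /S mulmxBr mulmxBl -scalemxAr -scalemxAl.
  have -> : v^T *m ((ursubmx A)^T *m ursubmx A) *m v =
      (ursubmx A *m v)^T *m (ursubmx A *m v) by rewrite trmx_mul !mulmxA.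
  set y := ursubmx A *m v; set q := v^T *m _ *m v => h.
  have -> : (q - a^-1 *: (y^T *m y)) 0 0 = q 0 0 - a^-1 * (y 0 0 * y 0 0).
    have yy : (y^T *m y) 0 0 = y 0 0 * y 0 0 by rewrite mxE big_ord1 mxE.
    by rewrite -yy; move: (y^T *m y) => t; rewrite !mxE.
  apply: (le_trans h); rewrite le_eqVlt; apply/orP; left; apply/eqP.
  by field; rewrite gt_eqF.
rewrite -{1}[A]submxK dlE.
have -> : block_mx (ulsubmx A) (ursubmx A) (ursubmx A)^T (drsubmx A) =
    block_mx 1%:M 0 (a^-1 *: (ursubmx A)^T) 1%:M *m
    block_mx (ulsubmx A) (ursubmx A) 0 S.
  rewrite mulmx_block !mul1mx !mul0mx ?mulmx0 !addr0; congr block_mx.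
    rewrite [ulsubmx A]mx11_scalar -/a mul_mx_scalar scalerA mulfV ?scale1r// gt_eqF//.
  by rewrite /S -scalemxAl addrC subrK.
by rewrite det_mulmx det_lblock !det1 !mul1r det_ublock det_mx11.
Qed.

(** A zero corner forces the rest of the first row to vanish: in the direction of a nonzero entry
    the form would be affine in the first coordinate with nonzero slope, and the chosen coordinate
    gives it the value -1. *)
Lemma psdmx_corner0 (R : realType) (m : nat) (A : 'M[R]_(1 + m)) :
  psdmx A -> ulsubmx A 0 0 = 0 -> \det A = 0.
Proof.
move=> [sA pA] a0.
have b0 : ursubmx A = 0.
  apply/rowP => j; rewrite [RHS]mxE; apply/eqP/negP => /negP bj.
  pose w : 'cV[R]_m := delta_mx j 0.
  have bw : (ursubmx A *m w) 0 0 = ursubmx A 0 j by rewrite /w -colE mxE.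
  set d := (w^T *m drsubmx A *m w) 0 0.
  have := pA (col_mx (- ((d + 1) / (2 * ursubmx A 0 j)))%:M w).
  rewrite quad_block// a0 mulr0 add0r bw -/d.
  have -> : 2 * (- ((d + 1) / (2 * ursubmx A 0 j))) * ursubmx A 0 j + d = - 1.
    by field.
  by rewrite ler0N1.
rewrite -[A]submxK b0 det_lblock det_mx11 a0 mul0r//.
Qed.

(** In terms of eigenvalues this is l <= exp (l - 1), multiplied out. Induction through Schur
    complements replaces diagonalisation: the pivot a satisfies a <= exp (a - 1), and passing to the
    complement does not increase the trace of the remaining block. *)
Lemma psdmx_det_le (R : realType) (m : nat) (A : 'M[R]_m) :
  psdmx A -> 0 <= \det A <= expR (\tr A - m%:R).
Proof.
elim: m A => [A _|m IH A pA]; first by rewrite det_mx00 /mxtrace big_ord0 subr0 expR0 lexx ler01.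
rewrite -[m.+1]/(1 + m)%N in A pA *.
have trE : \tr A = ulsubmx A 0 0 + \tr (drsubmx A).
  by rewrite -{1}[A]submxK mxtrace_block trace_mx11.
have [sA qA] := pA; have a0 : 0 <= ulsubmx A 0 0.
  have := qA (col_mx 1%:M 0); rewrite quad_block// !mulmx0 !mxE.
  by rewrite mulr0 !addr0 expr1n mul1r.
have [a_eq0|an0] := eqVneq (ulsubmx A 0 0) 0.
  by rewrite psdmx_corner0// lexx expR_ge0.
have a_gt0 : 0 < ulsubmx A 0 0 by rewrite lt_neqAle eq_sym an0.
have [pS ->] := psdmx_schur pA a_gt0.
have /andP[S0 S1] := IH _ pS; rewrite mulr_ge0//=.
move: S0 S1; set S := _ - _ => S0 S1.
have trS : \tr S <= \tr (drsubmx A).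
  rewrite /S linearB/= linearZ/= gerBl mulr_ge0 ?invr_ge0//.
  apply: sumr_ge0 => i _; rewrite mxE; apply: sumr_ge0 => k _.
  by rewrite !mxE -expr2 sqr_ge0.
have ea : ulsubmx A 0 0 <= expR (ulsubmx A 0 0 - 1).
  by rewrite (le_trans _ (expR_ge1Dx _))// addrC subrK.
apply: (@le_trans _ _ (expR (ulsubmx A 0 0 - 1) * expR (\tr S - m%:R))).
  exact: ler_pM.
by rewrite -expRD ler_expR trE natrD; lra.
Qed.

(** * Derivatives of pointwise limits *)

Lemma mean_value (R : realType) (f f' : R -> R) (b x y : R) : b < x -> b < y ->
  (forall z, b < z -> is_derive z 1 f (f' z)) ->
  exists c, [/\ b < c, `|c - x| <= `|y - x| & f y - f x = f' c * (y - x)].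
Proof.
move=> bx b_y df; have cf u v : b < u -> {within `[u, v], continuous f}.
  move=> bu; apply: derivable_within_continuous => t.
  by rewrite in_itv/= => /andP[ut _]; case: (df _ (lt_le_trans bu ut)).
have [xy|yx|<-] := ltgtP x y; last first.
- by exists x; split => //; rewrite !subrr mulr0.
- have dyx t : t \in `]y, x[ -> is_derive t 1 f (f' t).
    by rewrite in_itv/= => /andP[yt _]; apply: df; exact: lt_trans yt.
  have [c] := MVT yx dyx (cf _ _ b_y); rewrite in_itv/= => /andP[yc cx] fE.
  exists c; split; first exact: lt_trans yc.
  + by rewrite !ler0_norm; lra.
  + by rewrite -opprB fE -mulrN opprB.
- have dxy t : t \in `]x, y[ -> is_derive t 1 f (f' t).
    by rewrite in_itv/= => /andP[xt _]; apply: df; exact: lt_trans xt.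
  have [c] := MVT xy dxy (cf _ _ bx); rewrite in_itv/= => /andP[xc cy] fE.
  exists c; split => //; first exact: lt_trans xc.
  by rewrite !ger0_norm; lra.
Qed.

(** Two mean values suffice: f'(c) - f'(x) = f''(e) (c - x) with c no farther from x than y. The
    constant is B instead of B / 2, which is harmless here. *)
Lemma taylor1_le (R : realType) (f f' f'' : R -> R) (b B x y : R) : b < x -> b < y ->
  (forall z, b < z -> is_derive z 1 f (f' z)) ->
  (forall z, b < z -> is_derive z 1 f' (f'' z)) ->
  (forall z, b < z -> `|f'' z| <= B) ->
  `|f y - f x - f' x * (y - x)| <= B * `|y - x| ^+ 2.
Proof.
move=> bx b_y df df' f''B.
have [c [bc cxy ->]] := mean_value bx b_y df.
have [e [be _ f'E]] := mean_value bx bc df'.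
rewrite -mulrBl f'E !normrM expr2 mulrA ler_wpM2r//.
by rewrite ler_pM// f''B.
Qed.

Lemma is_derive_quadratic (R : realType) (f : R -> R) (x l B d : R) : 0 < d ->
  (forall h, `|h| < d -> `|f (x + h) - f x - l * h| <= B * `|h| ^+ 2) ->
  is_derive x 1 f l.
Proof.
move=> d0 fB; have B0 : 0 <= B.
  have h0 : 0 < d / 2 by lra.
  have h2 : `|d / 2| < d by rewrite gtr0_norm; lra.
  have := le_trans (normr_ge0 _) (fB _ h2).
  by rewrite pmulr_lge0// exprn_gt0// gtr0_norm.
suff cvl : h^-1 *: (f (h *: 1 + x) - f x) @[h --> 0^'] --> l.
  by split; [exact: cvgP cvl | exact: cvg_lim cvl].
apply/cvgrPdist_le => e e0; near=> h.
have hn0 : h != 0 by near: h; exact: nbhs_dnbhs_neq.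
have hd : `|h| < d.
  by near: h; apply: dnbhs0_lt.
(* [B + 1] keeps the denominator positive when [B] is 0. *)
have he : `|h| < e / (B + 1).
  by near: h; apply: dnbhs0_lt; rewrite divr_gt0//; lra.
have h0 : 0 < `|h| by rewrite normr_gt0.
have := fB h hd; rewrite /GRing.scale/= mulr1 (addrC h) => k.
have -> : l - h^-1 * (f (x + h) - f x) = - (f (x + h) - f x - l * h) / h by field.
rewrite normrM normrN normfV ler_pdivrMr//.
apply: (le_trans k); rewrite expr2 mulrA ler_wpM2r//.
have : B * `|h| <= (B + 1) * `|h| by rewrite ler_wpM2r; lra.
move=> /le_trans; apply; rewrite mulrC -ler_pdivlMr; [exact: ltW|lra].
Unshelve. all: by end_near. Qed.

(** By the uniform Taylor bound, [f' N z] stays within B h of a difference quotient of [f N], and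
    for fixed h that quotient converges in N. Hence [f' N z] is a Cauchy sequence; letting N tend to
    infinity in the same bound then differentiates [g]. *)
Lemma cvg_derivative (R : realType) (f f' f'' : nat -> R -> R) (g : R -> R) (a : R) :
  (forall N z, a < z -> is_derive z 1 (f N) (f' N z)) ->
  (forall N z, a < z -> is_derive z 1 (f' N) (f'' N z)) ->
  (forall b, a < b -> exists B, forall N z, b < z -> `|f'' N z| <= B) ->
  (forall z, a < z -> f N z @[N --> \oo] --> g z) ->
  forall z, a < z -> exists l, f' N z @[N --> \oo] --> l /\ is_derive z 1 g l.
Proof.
move=> df df' f''B fg z az; pose b := (a + z) / 2.
have ab : a < b by rewrite /b; lra.
have bz : b < z by rewrite /b; lra.
have [B hB] := f''B _ ab.
have B0 : 0 <= B by rewrite (le_trans (normr_ge0 (f'' 0 z)))// hB.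
have d0 : 0 < z - b by lra.
have near_z h : `|h| < z - b -> b < z + h by rewrite ltr_norml => /andP[]; lra.
have taylor N h : `|h| < z - b ->
    `|f N (z + h) - f N z - f' N z * h| <= B * `|h| ^+ 2.
  move=> /near_z bzh; have := @taylor1_le R (f N) (f' N) (f'' N) b B z (z + h) bz bzh.
  rewrite [z + h - z]addrAC subrr add0r; apply => t bt; [apply: df|apply: df'|exact: hB];
  exact: lt_trans bt.
have cz h : `|h| < z - b -> f N (z + h) - f N z @[N --> \oo] --> g (z + h) - g z.
  by move=> /near_z bzh; apply: cvgB; apply: fg => //; exact: lt_trans bzh.
have : cvg (f' N z @[N --> \oo]).
  apply/cauchy_cvgP/cauchy_exP => e e0.
  (* The step keeps [z + h] inside the region of the bound and makes the Taylor error at most e / 2;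
     the other half of e pays for the convergence in N. *)
  pose h := Num.min ((z - b) / 2) (e / (2 * (B + 1))).
  have B1 : 0 < B + 1 by lra.
  have h0 : 0 < h by rewrite lt_min !divr_gt0// mulr_gt0.
  have hd : `|h| < z - b by rewrite gtr0_norm// gt_min; apply/orP; left; lra.
  have he : B * h <= e / 2.
    have : (B + 1) * h <= e / 2.
      rewrite mulrC -ler_pdivlMr// -mulrA -invfM ge_min; apply/orP; right.
      by rewrite lexx.
    by apply: le_trans; rewrite ler_pM2r//; lra.
  exists ((g (z + h) - g z) / h).
  have e2 : 0 < e / 2 by lra.
  have eh : 0 < e / 2 * h by rewrite mulr_gt0.
  have /cvgrPdist_lt/(_ _ eh) := cz h hd.
  apply: filterS => N /= hN; rewrite -ball_normE/= /ball_.
  have := taylor N h hd; rewrite (gtr0_norm h0) => tN.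
  set q := g _ - _ in hN *; set p := f N _ - _ in hN tN.
  have -> : q / h - f' N z = ((q - p) + (p - f' N z * h)) / h by field; rewrite gt_eqF.
  rewrite normrM normfV (gtr0_norm h0) ltr_pdivrMr//.
  apply: (le_lt_trans (ler_normD _ _)).
  have : B * h ^+ 2 <= e / 2 * h by rewrite expr2 mulrA ler_wpM2r// ltW.
  by move: tN hN; lra.
move=> /cvg_ex[l cl]; exists l; split => //.
apply: (@is_derive_quadratic _ _ _ _ B _ d0) => h hd.
apply: (@cvgr_to_le _ \oo _ _ (fun N => `|f N (z + h) - f N z - f' N z * h|)); last first.
  by near=> N; exact: taylor.
by apply: cvg_norm; apply: cvgB; [exact: cz | apply: cvgMl].
Unshelve. all: by end_near. Qed.

(** * Gauss' limit formula *)

(** The order [k] counts derivatives in [z]. The normalisation in Gauss' formula, independent of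
    [z], is left out; it is restored as [ln (gamma 1) - ln_gauss 0 N 1], which avoids evaluating
    [gamma 1]. *)
Definition ln_gauss (R : realType) (k N : nat) (z : R) : R :=
  if k is k'.+1 then
    (k' == 0)%:R * ln N.+1%:R + (-1) ^+ k * k'`!%:R * \sum_(j < N) (z + j%:R) ^- k
  else z * ln N.+1%:R - \sum_(j < N) ln (z + j%:R).

Lemma is_derive_exprVn (R : realType) (k : nat) (x : R) : x != 0 ->
  is_derive x 1 (fun t : R => t ^- k) (- k%:R * x ^- k.+1).
Proof.
move=> x0; have xk0 : x ^+ k != 0 by rewrite expf_neq0.
have d : derivable (fun t : R => t ^+ k) x 1 by exact: exprn_derivable.
split; first exact: derivableV.
rewrite (@deriveV _ _ (fun t : R => t ^+ k)) //= exp_derive /GRing.scale/= mulr1.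
case: k {xk0 d} => [|k]; first by rewrite !mul0r mulr0 oppr0 mul0r.
rewrite /= !exprS expr0 mulr1; field.
by rewrite expf_neq0.
Qed.

Lemma is_derive_ln_gauss (R : realType) (k N : nat) (z : R) : 0 < z ->
  is_derive z 1 (ln_gauss k N) (ln_gauss k.+1 N z).
Proof.
move=> z0; have zj (j : nat) : 0 < z + j%:R by rewrite ltr_wpDr.
have dsh (j : nat) : is_derive z 1 (fun t : R => t + j%:R) 1.
  by apply: is_derive_eq; rewrite addr0.
case: k => [|k].
  have dln (j : 'I_N) : is_derive z 1 (fun t : R => ln (t + j%:R)) (z + j%:R)^-1.
    have d1 := is_derive1_ln (zj j); have d2 := dsh j.
    by have := @is_derive1_comp R (@ln R) (fun t => t + j%:R) z _ _ d1 d2; rewrite mulr1.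
  rewrite (_ : ln_gauss 0 N = (fun t => t * ln N.+1%:R) -
    \sum_(j < N) (fun t => ln (t + j%:R))); last first.
    by apply/funext => t; rewrite /ln_gauss/= !fctE fct_sumE.
  apply: is_derive_eq; rewrite /ln_gauss /GRing.scale/= fact0.
  under [in RHS]eq_bigr do rewrite expr1.
  ring.
have dV (j : 'I_N) : is_derive z 1 (fun t : R => (t + j%:R) ^- k.+1)
    (- k.+1%:R * (z + j%:R) ^- k.+2).
  have d1 := @is_derive_exprVn R k.+1 _ (lt0r_neq0 (zj j)); have d2 := dsh j.
  have := @is_derive1_comp R (fun t : R => t ^- k.+1) (fun t => t + j%:R) z _ _ d1 d2.
  by rewrite mulr1.
rewrite (_ : ln_gauss k.+1 N = cst ((k == 0)%:R * ln N.+1%:R) +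
  ((-1) ^+ k.+1 * k`!%:R) \*: \sum_(j < N) (fun t => (t + j%:R) ^- k.+1)); last first.
  by apply/funext => t; rewrite /ln_gauss !fctE fct_sumE.
apply: is_derive_eq; rewrite add0r /ln_gauss mul0r add0r /GRing.scale/= -mulr_sumr.
rewrite factS natrM.
by rewrite [(-1) ^+ k.+2]exprS; move: k.+1%:R ((-1) ^+ k.+1) (\sum_(i < N) _) => *; ring.
Qed.

(** Telescoping of u^-2 <= 1 / (u - 1) - 1 / u. *)
Lemma sum_inv_sqr_le (R : realType) (N : nat) (z : R) : 1 < z ->
  \sum_(j < N) (z + j%:R) ^- 2 <= (z - 1)^-1.
Proof.
move=> z1; suff : \sum_(j < N) (z + j%:R) ^- 2 <= (z - 1)^-1 - (z + N%:R - 1)^-1.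
  move=> /le_trans; apply; rewrite gerBl invr_ge0.
  by have := ler0n R N; lra.
elim: N => [|N IH]; first by rewrite big_ord0 addr0 subrr.
rewrite big_ord_recr/=; have N0 := ler0n R N; move: IH; rewrite -natr1.
set S := \sum_(_ < _) _; set u := z + N%:R => IH.
have -> : z + (N%:R + 1) - 1 = u by rewrite /u; ring.
suff : u ^- 2 <= (u - 1)^-1 - u^-1 by move: IH; lra.
have u1 : 0 < u - 1 by rewrite /u; lra.
have u0 : 0 < u by lra.
have -> : (u - 1)^-1 - u^-1 = ((u - 1) * u)^-1 by field; rewrite !gt_eqF.
by rewrite lef_pV2 ?posrE ?mulr_gt0// expr2 ler_wpM2r; lra.
Qed.

(** This is the bound, uniform in [N], that [cvg_derivative] asks for. From order 2 on the term in
    ln (N + 1) is gone, and z + j >= 1 reduces every exponent to 2. *)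
Lemma ln_gauss_bounded (R : realType) (k N : nat) (b z : R) : 1 < b -> b < z ->
  `|ln_gauss k.+2 N z| <= k.+1`!%:R / (b - 1).
Proof.
move=> b1 bz; rewrite /ln_gauss mul0r add0r normrM normrM normrX normrN1 expr1n mul1r.
rewrite ger0_norm// ler_wpM2l//.
have z1 : 1 < z by lra.
have zj (j : nat) : 1 <= z + j%:R by have := ler0n R j; lra.
rewrite ger0_norm; last first.
  by apply: sumr_ge0 => j _; rewrite invr_ge0 exprn_ge0// (le_trans _ (zj j)).
apply: (@le_trans _ _ (\sum_(j < N) (z + j%:R) ^- 2)).
  apply: ler_sum => j _; have zj0 := lt_le_trans ltr01 (zj j).
  by rewrite lef_pV2 ?posrE ?exprn_gt0// ler_weXn2l.
apply: (le_trans (sum_inv_sqr_le _ z1)).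
by rewrite lef_pV2 ?posrE; lra.
Qed.

Lemma ln_ratio_bounds (R : realType) (N : nat) (z : R) : 1 <= z ->
  0 <= ln (N%:R + z) - ln N.+1%:R <= (z - 1) / N.+1%:R.
Proof.
move=> z1; have N0 := ler0n R N; have n0 : (0 : R) < N.+1%:R by rewrite ltr0n.
have Nz : 0 < N%:R + z by lra.
rewrite subr_ge0 ler_ln ?posrE// -natr1 lerD2l z1/=.
have n1 : (0 : R) < N%:R + 1 by rewrite natr1.
have := ln_tangent n1 Nz; rewrite opprD addrACA subrr add0r; lra.
Qed.

Lemma cvg_ln_ratio (R : realType) (z : R) : 1 <= z ->
  ln (N%:R + z) - ln N.+1%:R @[N --> \oo] --> 0.
Proof.
move=> z1; apply: (@squeeze_cvgr _ _ _ _ (fun=> 0) (fun N : nat => (z - 1) * N.+1%:R^-1)).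
- by near=> N; exact: ln_ratio_bounds.
- exact: cvg_cst.
- by rewrite -(mulr0 (z - 1)); apply: cvgMr; exact: cvg_harmonic.
Unshelve. all: by end_near. Qed.

Lemma ln_gammaDn (R : realType) (N : nat) (z : R) : 1 <= z ->
  ln (gamma (N%:R + z)) = ln (gamma z) + \sum_(j < N) ln (z + j%:R).
Proof.
move=> z1; elim: N => [|N IH]; first by rewrite add0r big_ord0 addr0.
have z1N : 1 <= N%:R + z by rewrite (le_trans z1)// lerDr.
rewrite big_ord_recr/= addrA -IH -natr1 addrAC gammaS// lnM ?posrE ?gamma_gt0//.
  by rewrite [RHS]addrC [z + _]addrC.
exact: lt_le_trans z1N.
Qed.

Lemma ln_gammaD_le (R : realType) (z s : R) : 1 <= z -> 0 <= s <= 1 ->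
  ln (gamma (z + s)) <= s * ln z + ln (gamma z).
Proof.
move=> z1 /[dup] /andP[s0 _] s01; have z0 : 0 < z by lra.
rewrite -ln_powR -lnM ?posrE ?gamma_gt0 ?powR_gt0//.
rewrite ler_ln ?posrE ?mulr_gt0 ?gamma_gt0 ?powR_gt0//; first exact: gammaD_le.
by lra.
Qed.

(** The linear arithmetic of the next lemma, with A = ln (N + 1), B = ln (N + z), G and H the values
    of ln gamma at N + 1 and N + z, g1 and gz those at 1 and z, and S1 and Sz the sums of
    logarithms. *)
Fact error_bounds_arith (R : realType) (z A B S1 Sz g1 gz G H : R) :
  H <= (z - 1) * A + G -> A + G <= (1 - (z - 1)) * B + H ->
  0 <= (z - 1) * (B - A) -> H = gz + Sz -> G = g1 + S1 ->
  0 <= z * A - Sz + (g1 - (A - S1)) - gz <= B - A.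
Proof. by move=> h1 h2 h3 e1 e2; subst H G; apply/andP; split; lra. Qed.

(** Bohr-Mollerup squeeze: the concavity estimate is used from N + 1 to N + z and from N + z to N +
    2. Both steps have length at most 1, whence the restriction on [z]. *)
Lemma ln_gauss_error_bounds (R : realType) (N : nat) (z : R) : 1 <= z <= 2 ->
  0 <= ln_gauss 0 N z + (ln (gamma 1) - ln_gauss 0 N 1) - ln (gamma z)
    <= ln (N%:R + z) - ln N.+1%:R.
Proof.
move=> /andP[z1 z2]; rewrite /ln_gauss -natr1 mul1r.
have N0 := ler0n R N.
have Nz1 : 1 <= N%:R + z by lra.
have N1 : (1 : R) <= N%:R + 1 by lra.
have N1_gt0 : (0 : R) < N%:R + 1 by lra.
have s1 : 0 <= z - 1 <= 1 by lra.
have s2 : 0 <= 1 - (z - 1) <= 1 by lra.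
have AB : ln (N%:R + 1) <= ln (N%:R + z).
  by have := ln_ratio_bounds N z1; rewrite -natr1 subr_ge0 => /andP[].
have h1 := ln_gammaD_le N1 s1; have h2 := ln_gammaD_le Nz1 s2.
have e1 := ln_gammaDn N z1; have e2 := ln_gammaDn N (lexx (1 : R)).
have e3 : ln (gamma (N%:R + z + (1 - (z - 1)))) = ln (N%:R + 1) + ln (gamma (N%:R + 1)).
  rewrite (_ : N%:R + z + _ = N%:R + 1 + 1); last by ring.
  by rewrite (gammaS N1) (lnM N1_gt0 (gamma_gt0 N1)).
have e4 : N%:R + 1 + (z - 1) = N%:R + z by ring.
rewrite e3 in h2; rewrite e4 in h1.
have s0 : 0 <= (z - 1) * (ln (N%:R + z) - ln (N%:R + 1)).
  by rewrite mulr_ge0 ?subr_ge0.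
exact: error_bounds_arith h1 h2 s0 e1 e2.
Qed.

Lemma cvg_ln_gauss_base (R : realType) (z : R) : 1 <= z <= 2 ->
  ln_gauss 0 N z + (ln (gamma 1) - ln_gauss 0 N 1) @[N --> \oo] --> ln (gamma z).
Proof.
move=> z12; apply/subr_cvg0.
apply: (@squeeze_cvgr _ _ _ _ (fun=> 0) (fun N : nat => ln (N%:R + z) - ln N.+1%:R)).
- by near=> N; exact: ln_gauss_error_bounds.
- exact: cvg_cst.
- by apply: cvg_ln_ratio; case/andP: z12.
Unshelve. all: by end_near. Qed.

Lemma sum_shift1 (R : nzRingType) (f : R -> R) (N : nat) (w : R) :
  \sum_(j < N) f (w + 1 + j%:R) = \sum_(j < N) f (w + j%:R) + f (w + N%:R) - f w.
Proof.
elim: N => [|N IH]; first by rewrite !big_ord0 addr0 add0r subrr.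
rewrite big_ord_recr/= IH [in RHS]big_ord_recr/= -natr1 [N%:R + 1]addrC [w + (1 + _)]addrA.
exact: addrAC.
Qed.

(** Unit shifts extend the convergence from [1, 2]: Gauss' approximation obeys the functional
    equation up to ln (N + z - 1) - ln (N + 1), which tends to 0. *)
Lemma cvg_ln_gauss (R : realType) (z : R) : 1 <= z ->
  ln_gauss 0 N z + (ln (gamma 1) - ln_gauss 0 N 1) @[N --> \oo] --> ln (gamma z).
Proof.
move=> z1; have [n zn] : exists n : nat, z <= n.+2%:R.
  exists (Num.bound `|z|); rewrite (le_trans (ler_norm _))// ltW//.
  by apply: lt_le_trans (archi_boundP (normr_ge0 z)) _; rewrite ler_nat -addn2 leq_addr.
elim: n z z1 zn => [|n IH] z z1 zn; first by apply: cvg_ln_gauss_base; rewrite z1.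
have [/(IH _ z1)//|nz] := leP z n.+2%:R.
have w1 : 1 <= z - 1.
  have n2 : (2 : R) <= n.+2%:R by rewrite ler_nat.
  by clear IH; lra.
have w0 : 0 < z - 1 by lra.
have wn : z - 1 <= n.+2%:R by rewrite lerBlDr natr1.
have -> : ln (gamma z) = ln (gamma (z - 1)) + ln (z - 1) - 0.
  by rewrite -{1}(subrK 1 z) gammaS// lnM ?posrE ?gamma_gt0// subr0 addrC.
have -> : (fun N => ln_gauss 0 N z + (ln (gamma 1) - ln_gauss 0 N 1)) =
    (fun N => ln_gauss 0 N (z - 1) + (ln (gamma 1) - ln_gauss 0 N 1) + ln (z - 1)
      - (ln (N%:R + (z - 1)) - ln N.+1%:R)).
  apply/funext => N; rewrite /ln_gauss.
  have -> : \sum_(j < N) ln (z + j%:R) =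
      \sum_(j < N) ln (z - 1 + j%:R) + ln (N%:R + (z - 1)) - ln (z - 1).
    have := sum_shift1 (@ln R) N (z - 1); rewrite subrK => ->.
    by rewrite [z - 1 + N%:R]addrC.
  by ring.
apply: cvgB; last exact: cvg_ln_ratio.
by apply: cvgD; [exact: IH | exact: cvg_cst].
Qed.

(* Indexed so that polygamma k is the k-th derivative of ln gamma on ]1, +oo[;
   the usual convention counts the derivatives of gamma'/gamma. *)
Definition polygamma (R : realType) (k : nat) (z : R) : R :=
  if k is 0 then ln (gamma z) else limn (fun N => ln_gauss k N z).

(** Limits climb by induction on the order: convergence at one order yields, through
    [cvg_derivative], convergence at the next and the fact that the new limit is the derivative of
    the old one. *)
Lemma polygamma_spec (R : realType) (k : nat) (z : R) : 1 < z ->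
  ln_gauss k.+1 N z @[N --> \oo] --> polygamma k.+1 z /\
  is_derive z 1 (polygamma k) (polygamma k.+1 z).
Proof.
(* The normalising constant enters at order 0 only, so that all orders form one tower of
   derivatives. *)
pose f (k N : nat) (z : R) :=
  ln_gauss k N z + (k == 0)%:R * (ln (gamma 1) - ln_gauss 0 N 1).
have fS k0 N w : f k0.+1 N w = ln_gauss k0.+1 N w by rewrite /f mul0r addr0.
have df k0 N (w : R) : 1 < w -> is_derive w 1 (f k0 N) (f k0.+1 N w).
  move=> w1; have w0 : 0 < w by lra.
  have d := is_derive_ln_gauss k0 N w0; rewrite fS.
  rewrite (_ : f k0 N = ln_gauss k0 N + cst ((k0 == 0)%:R * (ln (gamma 1) - ln_gauss 0 N 1))) //.
  by apply: is_derive_eq; rewrite addr0.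
have fB k0 (b : R) : 1 < b -> exists B, forall N w, b < w -> `|f k0.+2 N w| <= B.
  move=> b1; exists (k0.+1`!%:R / (b - 1)) => N w bw; rewrite fS.
  exact: ln_gauss_bounded.
suff cf k0 (w : R) : 1 < w -> f k0 N w @[N --> \oo] --> polygamma k0 w.
  move=> z1; have [l [cl dl]] := cvg_derivative (df k) (df k.+1) (fB k) (cf k) z1.
  have e : polygamma k.+1 z = l.
    by apply: cvg_lim => //; move: cl; under eq_cvg do rewrite fS.
  by rewrite e; split => //; move: cl; under eq_cvg do rewrite fS.
elim: k0 w => [|k0 IH] w w1.
  by rewrite /f; under eq_cvg do rewrite eqxx mul1r; apply: cvg_ln_gauss; rewrite ltW.
have [l [cl _]] := cvg_derivative (df k0) (df k0.+1) (fB k0) IH w1.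
rewrite (_ : polygamma k0.+1 w = l)//; apply: cvg_lim => //.
by move: cl; under eq_cvg do rewrite fS.
Qed.

(** * Monotonicity in the scale *)

(** Convexity of u^-k: its drop over [u, u + 1] is at most minus its slope at u. *)
Lemma exprVn_diff_le (R : realType) (k : nat) (u : R) : 0 < u ->
  u ^- k - (u + 1) ^- k <= k%:R * u ^- k.+1.
Proof.
move=> u0; have u1 : 0 < u + 1 by lra.
elim: k => [|k IH]; first by rewrite !expr0 subrr mul0r.
have v0 := lt0r_neq0 u0; have v1 := lt0r_neq0 u1.
have -> : u ^- k.+1 - (u + 1) ^- k.+1 =
    u^-1 * (u ^- k - (u + 1) ^- k) + (u + 1) ^- k * (u^-1 - (u + 1)^-1).
  by rewrite !exprS; field; rewrite !expf_neq0 ?v0 ?v1.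
have -> : k.+1%:R * u ^- k.+2 = u^-1 * (k%:R * u ^- k.+1) + u ^- k * u ^- 2.
  by rewrite !exprS expr0 -natr1; field; rewrite !expf_neq0 ?v0.
apply: lerD; first by rewrite ler_wpM2l ?invr_ge0// ltW.
have -> : u^-1 - (u + 1)^-1 = (u * (u + 1))^-1 by field; rewrite v0 v1.
apply: ler_pM.
- by rewrite invr_ge0 exprn_ge0// ltW.
- by rewrite invr_ge0 mulr_ge0// ltW.
- by rewrite lef_pV2 ?posrE ?exprn_gt0// lerXn2r ?nnegrE; lra.
- by rewrite lef_pV2 ?posrE ?exprn_gt0 ?mulr_gt0// expr2 ler_pM2l//; lra.
Qed.

(* The summand is - q'(t) for q(t) = t / (y + t)^(p + 1); it dominates
   P(t) - P(t + 1) with P(t) = (t - 1) / (y + t)^(p + 1), so the sum telescopes. *)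
Lemma sum_scale_deriv_ge (R : realType) (p N : nat) (y c : R) : 0 < y -> 1 <= c ->
  - (y + c + N%:R) ^- p <=
  \sum_(j < N) (p%:R * (c + j%:R) - y) * (y + c + j%:R) ^- p.+2.
Proof.
move=> y0 c1; pose P (t : R) := (t - 1) * (y + t) ^- p.+1.
have term (t : R) : 0 < t -> P t - P (t + 1) <= (p%:R * t - y) * (y + t) ^- p.+2.
  move=> t0; have u0 : 0 < y + t by lra.
  have := ler_wpM2l (ltW t0) (exprVn_diff_le p.+1 u0); rewrite -subr_ge0 => h.
  rewrite -subr_ge0; apply: (le_trans h); rewrite le_eqVlt; apply/orP; left; apply/eqP.
  rewrite /P -natr1 [y + (t + 1)]addrA.
  have -> : (y + t) ^- p.+1 = (y + t) * (y + t) ^- p.+2.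
    by rewrite [in RHS]exprS; field; rewrite expf_neq0 (lt0r_neq0 u0).
  by move: ((y + t) ^- p.+2) ((y + t + 1) ^- p.+1) => *; ring.
have sumP : P c - P (c + N%:R) <=
    \sum_(j < N) (p%:R * (c + j%:R) - y) * (y + c + j%:R) ^- p.+2.
  elim: N => [|N IH]; first by rewrite big_ord0 addr0 subrr.
  rewrite big_ord_recr/= -natr1 addrA; have N0 := ler0n R N.
  have := term (c + N%:R) ltac:(lra); rewrite addrA; move: IH; lra.
apply: le_trans sumP.
have N0 := ler0n R N; have u0 : 0 < y + c + N%:R by lra.
(* The bound 1 <= c makes this first boundary term nonnegative; only the last one is lost. *)
have Pc : 0 <= P c by rewrite /P mulr_ge0 ?invr_ge0 ?exprn_ge0//; lra.
suff : P (c + N%:R) <= (y + c + N%:R) ^- p by lra.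
have -> : (y + c + N%:R) ^- p = (y + c + N%:R) * (y + c + N%:R) ^- p.+1.
  by rewrite exprS; field; rewrite expf_neq0 (lt0r_neq0 u0).
rewrite /P [y + (c + _)]addrA ler_wpM2r ?invr_ge0 ?exprn_ge0 ?ltW//; lra.
Qed.

(** The approximation to h_j as a function of the scale [a], for derivatives of order [p + 1],
    including the corrective [ln a] at p = 0. *)
Definition scaled_gauss (R : realType) (p N : nat) (x c a : R) : R :=
  (p == 0)%:R * ln a + (-1) ^+ p.+1 * (a ^+ p * ln_gauss p.+1 N (x * a + c)).

Lemma scaled_gaussE (R : realType) (p N : nat) (x c a : R) :
  scaled_gauss p N x c a = (p == 0)%:R * (ln a - ln N.+1%:R) +
    p`!%:R * \sum_(j < N) a ^+ p * (x * a + c + j%:R) ^- p.+1.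
Proof.
rewrite /scaled_gauss /ln_gauss -mulr_sumr.
have s1 : (-1) ^+ p.+1 * (-1) ^+ p.+1 = 1 :> R by rewrite -exprMn mulrN1 opprK expr1n.
set S := \sum_(_ < _) _.
have -> : (-1) ^+ p.+1 * (a ^+ p * ((p == 0)%:R * ln N.+1%:R +
      (-1) ^+ p.+1 * p`!%:R * S)) =
    (p == 0)%:R * ((-1) ^+ p.+1 * a ^+ p * ln N.+1%:R) +
    ((-1) ^+ p.+1 * (-1) ^+ p.+1) * (p`!%:R * (a ^+ p * S)) by ring.
rewrite s1 mul1r addrA -mulrDr; congr (_ + _).
by case: p {S s1} => [|p]; rewrite ?mul0r// expr1 expr0 mulr1 mulN1r.
Qed.

(** The factor 1 / a is pulled out so that the remaining sum is that of [sum_scale_deriv_ge] at y =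
    x a. *)
Lemma is_derive_scaled_gauss (R : realType) (p N : nat) (x c a : R) :
  0 < x -> 0 < c -> 0 < a ->
  is_derive a 1 (scaled_gauss p N x c) (a^-1 * ((p == 0)%:R + p`!%:R * a ^+ p *
    \sum_(j < N) (p%:R * (c + j%:R) - x * a) * (x * a + c + j%:R) ^- p.+2)).
Proof.
move=> x0 c0 a0; have xa0 : 0 < x * a by rewrite mulr_gt0.
have an0 := lt0r_neq0 a0.
have dln := is_derive1_ln a0.
have dterm (j : 'I_N) : is_derive a 1
    (fun s : R => s ^+ p * (x * s + c + j%:R) ^- p.+1)
    (a^-1 * a ^+ p * ((p%:R * (c + j%:R) - x * a) * (x * a + c + j%:R) ^- p.+2)).
  have u0 : x * a + c + j%:R != 0 by rewrite lt0r_neq0//; have := ler0n R j; lra.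
  have d1 := is_derive_exprVn p.+1 u0.
  have d2 : is_derive a 1 (fun s : R => x * s + c + j%:R) x.
    by apply: is_derive_eq; rewrite /GRing.scale/= ; ring.
  have d3 := @is_derive1_comp R (fun t : R => t ^- p.+1)
    (fun s => x * s + c + j%:R) a _ _ d1 d2.
  have d4 : is_derive a 1 (fun s : R => s ^+ p) (p%:R * a ^+ p.-1).
    by split; [exact: exprn_derivable | rewrite exp_derive /GRing.scale/= mulr1].
  have := is_deriveM d4 d3; rewrite /GRing.scale/= => d5.
  apply: is_derive_eq d5 _.
  have -> : p%:R * a ^+ p.-1 = p%:R * (a^-1 * a ^+ p).
    by case: (p) => [|q]; rewrite ?mul0r//= exprS mulKf.
  rewrite /= [in X in _ + X = _](_ : (x * a + c + j%:R) ^- p.+1 =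
    (x * a + c + j%:R) * (x * a + c + j%:R) ^- p.+2); last first.
    by rewrite [in RHS]exprS; field; rewrite expf_neq0.
  rewrite -natr1; move: ((x * a + c + j%:R) ^- p.+2) => v.
  by field.
rewrite (_ : scaled_gauss p N x c = (p == 0)%:R \*: (@ln R - cst (ln N.+1%:R)) +
   p`!%:R \*: \sum_(j < N) (fun s : R => s ^+ p * (x * s + c + j%:R) ^- p.+1)); last first.
  by apply/funext => s; rewrite scaled_gaussE !fctE fct_sumE.
apply: is_derive_eq; rewrite /GRing.scale/= -mulr_sumr subr0; ring.
Qed.

(** At the mean value point s the sum is at least - (x s + c + N)^-p. For p = 0 this is -1, exactly
    offset by the 1 coming from [ln]; for p > 0 it is at least - 1 / (N + 1), and s^-1 <= a^-1 with
    s^p <= b^p gives the constant of the error. *)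
Lemma scaled_gauss_quasi_mono (R : realType) (p N : nat) (x c a b : R) :
  0 < x -> 1 <= c -> 0 < a -> a <= b ->
  scaled_gauss p N x c a - a^-1 * (p`!%:R * b ^+ p) * (b - a) / N.+1%:R
    <= scaled_gauss p N x c b.
Proof.
move=> x0 c1 a0 ab; have c0 : 0 < c by lra.
have df s : s \in `]a, b[ -> is_derive s 1 (scaled_gauss p N x c) (s^-1 * ((p == 0)%:R +
    p`!%:R * s ^+ p * \sum_(j < N) (p%:R * (c + j%:R) - x * s) * (x * s + c + j%:R) ^- p.+2)).
  rewrite in_itv/= => /andP[s1 _]; apply: is_derive_scaled_gauss => //; lra.
have cf : {within `[a, b], continuous (scaled_gauss p N x c)}.
  apply: derivable_within_continuous => s; rewrite in_itv/= => /andP[s1 _].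
  by case: (@is_derive_scaled_gauss R p N x c s x0 c0 ltac:(lra)).
have [s] := MVT_segment ab df cf; rewrite in_itv/= => /andP[as_ sb] e.
have s0 : 0 < s by lra.
have N0 := ler0n R N; have n0 : (0 : R) < N.+1%:R by rewrite ltr0n.
have xs0 : 0 < x * s by rewrite mulr_gt0.
set K := a^-1 * _; suff : - (K / N.+1%:R) <= s^-1 * ((p == 0)%:R + p`!%:R * s ^+ p *
    \sum_(j < N) (p%:R * (c + j%:R) - x * s) * (x * s + c + j%:R) ^- p.+2).
  have ba : 0 <= b - a by rewrite subr_ge0.
  move=> /(ler_wpM2r ba); rewrite -e mulNr [K * _ / _]mulrAC => h.
  by move: h; rewrite lerBrDr addrC.
set S := \sum_(_ < _) _.
have hS : - (x * s + c + N%:R) ^- p <= S := sum_scale_deriv_ge p N xs0 c1.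
have K0 : 0 <= K by rewrite !mulr_ge0 ?invr_ge0 ?exprn_ge0//; lra.
case: p @K K0 S e df cf hS => [|p] K K0 S _ _ _ hS.
  apply: (@le_trans _ _ 0); first by rewrite oppr_le0 divr_ge0.
  rewrite fact0 !expr0 invr1 in hS *; rewrite eqxx mulr1n !mul1r.
  by rewrite mulr_ge0 ?invr_ge0 ?(ltW s0)// -lerBlDl sub0r.
rewrite [(_ == _)%:R]/= add0r.
have u0 : 0 < x * s + c + N%:R by lra.
have hu : (x * s + c + N%:R) ^- p.+1 <= N.+1%:R^-1.
  rewrite lef_pV2 ?posrE ?exprn_gt0// -natr1.
  have u1 : N%:R + 1 <= x * s + c + N%:R by lra.
  apply: (le_trans u1); rewrite -[leLHS]expr1 ler_weXn2l//; lra.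
have sK : s^-1 * (p.+1`!%:R * s ^+ p.+1) <= K.
  rewrite /K; apply: ler_pM.
  - by rewrite invr_ge0 ltW.
  - by rewrite mulr_ge0 ?exprn_ge0 ?(ltW s0).
  - by rewrite lef_pV2.
  - by rewrite ler_wpM2l// lerXn2r ?nnegrE//; lra.
have sK0 : 0 <= s^-1 * (p.+1`!%:R * s ^+ p.+1).
  by rewrite !mulr_ge0 ?invr_ge0 ?exprn_ge0// ltW.
rewrite mulrA; apply: (@le_trans _ _ (s^-1 * (p.+1`!%:R * s ^+ p.+1) * - N.+1%:R^-1)).
  by rewrite mulrN lerN2 ler_wpM2r// invr_ge0.
by rewrite ler_wpM2l//; apply: le_trans hS; rewrite lerN2.
Qed.

Lemma polygamma_scale_mono (R : realType) (p : nat) (x c a b : R) :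
  0 < x -> 1 <= c -> 0 < a -> a <= b ->
  (p == 0)%:R * ln a + (-1) ^+ p.+1 * (a ^+ p * polygamma p.+1 (x * a + c)) <=
  (p == 0)%:R * ln b + (-1) ^+ p.+1 * (b ^+ p * polygamma p.+1 (x * b + c)).
Proof.
move=> x0 c1 a0 ab; have b0 : 0 < b by lra.
have cG s : 0 < s -> scaled_gauss p N x c s @[N --> \oo] -->
    (p == 0)%:R * ln s + (-1) ^+ p.+1 * (s ^+ p * polygamma p.+1 (x * s + c)).
  move=> s0; have xs0 : 0 < x * s by rewrite mulr_gt0.
  have z1 : 1 < x * s + c by lra.
  have [cl _] := polygamma_spec p z1.
  by apply: cvgD; [exact: cvg_cst | do 2 apply: cvgMr].
pose K := a^-1 * (p`!%:R * b ^+ p) * (b - a).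
rewrite -[leLHS]subr0 -(mulr0 K).
apply: (@ler_cvg_to _ _ _ _ (fun N => scaled_gauss p N x c a - K / N.+1%:R) _ _ _ _ (cG b b0)).
  by apply: cvgB; [exact: cG | apply: cvgMr; exact: cvg_harmonic].
by near=> N; exact: scaled_gauss_quasi_mono.
Unshelve. all: by end_near. Qed.

(** * Smooth functions on the positive reals *)

(** Recursion on the derivative lets closure properties go by induction, and since the half-line is
    open only values at positive points matter. *)
Fixpoint nderivable_pos (R : realType) (k : nat) (f : R -> R) : Prop :=
  if k is k'.+1 then (forall x, 0 < x -> derivable f x 1) /\ nderivable_pos k' (derive1 f)
  else True.

Lemma derive1_eq_pos (R : realType) (f g : R -> R) :
  (forall x, 0 < x -> f x = g x) -> forall x, 0 < x -> derive1 f x = derive1 g x.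
Proof.
move=> fg x x0; rewrite !derive1E; apply: near_eq_derive => //.
by near=> y; apply: fg; near: y; exact: lt_nbhsr.
Unshelve. all: by end_near. Qed.

Lemma derivable_eq_pos (R : realType) (f g : R -> R) :
  (forall x, 0 < x -> f x = g x) -> forall x, 0 < x -> derivable f x 1 -> derivable g x 1.
Proof.
move=> fg x x0; apply: near_eq_derivable => //.
by near=> y; apply: fg; near: y; exact: lt_nbhsr.
Unshelve. all: by end_near. Qed.

Lemma nderivable_pos_eq (R : realType) (k : nat) (f g : R -> R) :
  (forall x, 0 < x -> f x = g x) -> nderivable_pos k f -> nderivable_pos k g.
Proof.
elim: k f g => [//|k IH] f g fg /= [df kf]; split.
  by move=> x x0; apply: derivable_eq_pos fg _ x0 (df _ x0).
exact: IH (derive1_eq_pos fg) kf.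
Qed.

Lemma nderivable_posS (R : realType) (k : nat) (f f' : R -> R) :
  (forall x : R, 0 < x -> is_derive x 1 f (f' x)) -> nderivable_pos k f' ->
  nderivable_pos k.+1 f.
Proof.
move=> df kf'; split; first by move=> x /df[].
by apply: nderivable_pos_eq kf' => x /df[_ <-]; rewrite derive1E.
Qed.

Lemma nderivable_posW (R : realType) (k : nat) (f : R -> R) :
  nderivable_pos k.+1 f -> nderivable_pos k f.
Proof. by elim: k f => [//|k IH] f [df kf]; split => //; exact: IH. Qed.

Lemma is_derive_pos (R : realType) (k : nat) (f : R -> R) (x : R) :
  nderivable_pos k.+1 f -> 0 < x -> is_derive x 1 f (derive1 f x).
Proof. by move=> [df _] x0; rewrite derive1E; apply: derivableP; exact: df. Qed.

Lemma nderivable_posD (R : realType) (k : nat) (f g : R -> R) :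
  nderivable_pos k f -> nderivable_pos k g -> nderivable_pos k (f + g).
Proof.
elim: k f g => [//|k IH] f g kf kg.
apply: (@nderivable_posS _ _ _ (derive1 f + derive1 g)); last by apply: IH; [case: kf|case: kg].
move=> x x0; have df := is_derive_pos kf x0; have dg := is_derive_pos kg x0.
exact: is_deriveD.
Qed.

Lemma nderivable_posM (R : realType) (k : nat) (f g : R -> R) :
  nderivable_pos k f -> nderivable_pos k g -> nderivable_pos k (f * g).
Proof.
elim: k f g => [//|k IH] f g kf kg.
apply: (@nderivable_posS _ _ _ (f * derive1 g + g * derive1 f)).
  move=> x x0; have df := is_derive_pos kf x0; have dg := is_derive_pos kg x0.
  exact: is_deriveM.
apply: nderivable_posD; apply: IH.
- exact: nderivable_posW.
- by case: kg.
- exact: nderivable_posW.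
- by case: kf.
Qed.

(** Bootstrap: if [f] has k derivatives, so has f' = f v, hence [f] has k + 1. *)
Lemma nderivable_pos_log_derivative (R : realType) (k : nat) (f v : R -> R) :
  (forall x : R, 0 < x -> is_derive x 1 f (f x * v x)) -> (forall j, nderivable_pos j v) ->
  nderivable_pos k f.
Proof.
move=> df kv; elim: k => [//|k IH].
by apply: (@nderivable_posS _ _ _ (f * v)) => //; exact: nderivable_posM.
Qed.

Lemma nderivable_pos_tower (R : realType) (u : nat -> R -> R) :
  (forall k (x : R), 0 < x -> is_derive x 1 (u k) (u k.+1 x)) ->
  forall k j, nderivable_pos j (u k).
Proof. by move=> du k j; elim: j k => [//|j IH] k; apply: nderivable_posS (du k) _. Qed.

Lemma derive1n_tower (R : realType) (u : nat -> R -> R) (f : R -> R) :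
  (forall k (x : R), 0 < x -> is_derive x 1 (u k) (u k.+1 x)) ->
  (forall x, 0 < x -> f x = u 0 x) ->
  forall k x, 0 < x -> derive1n k f x = u k x.
Proof.
move=> du fu; elim=> [//|k IH] x x0; rewrite derive1nS.
by rewrite (derive1_eq_pos IH)// derive1E; case: (du k x x0).
Qed.

Lemma derivable_derive1n (R : realType) (f : R -> R) (k : nat) (x : R) :
  (forall j, nderivable_pos j f) -> 0 < x -> derivable (derive1n k f) x 1.
Proof.
move=> kf; have : nderivable_pos 1 (derive1n k f).
  suff : forall i j (g : R -> R), nderivable_pos (i + j) g -> nderivable_pos j (derive1n i g).
    by apply; exact: kf.
  by elim=> [//|i IH] j g [_ /IH]; rewrite /derive1n -iterSr.
by case=> d _; exact: d.
Qed.

Lemma is_derive_bigsum (R : realType) (n : nat) (F : 'I_n -> R -> R) (dF : 'I_n -> R) (x : R) :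
  (forall i, is_derive x 1 (F i) (dF i)) ->
  is_derive x 1 (fun t => \sum_(i < n) F i t) (\sum_(i < n) dF i).
Proof.
move=> d; rewrite (_ : (fun _ => _) = \sum_(i < n) F i); first exact: is_derive_sum.
by apply/funext => t; rewrite fct_sumE.
Qed.

Lemma ln_prod (R : realType) (n : nat) (F : 'I_n -> R) :
  (forall i, 0 < F i) -> ln (\prod_(i < n) F i) = \sum_(i < n) ln (F i).
Proof.
move=> F0; elim: n F F0 => [|n IH] F F0; first by rewrite !big_ord0 ln1.
by rewrite !big_ord_recl lnM ?posrE ?IH// prodr_gt0.
Qed.

(** * The logarithm of Q *)

(** The [k]-th derivative in [x] of ln gamma (x a + c), the power of [a] coming from the chain
    rule. *)
Definition scaled_polygamma (R : realType) (a c : R) (k : nat) (x : R) : R :=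
  a ^+ k * polygamma k (x * a + c).

Lemma is_derive_scaled_polygamma (R : realType) (a c : R) (k : nat) (x : R) :
  0 < a -> 1 <= c -> 0 < x ->
  is_derive x 1 (scaled_polygamma a c k) (scaled_polygamma a c k.+1 x).
Proof.
move=> a0 c1 x0; have xa0 : 0 < x * a by rewrite mulr_gt0.
have z1 : 1 < x * a + c by lra.
have [_ d1] := polygamma_spec k z1.
have d2 : is_derive x 1 (fun s : R => s * a + c) a.
  by apply: is_derive_eq; rewrite /GRing.scale/=; ring.
have d3 := @is_derive1_comp R (polygamma k) (fun s => s * a + c) x _ _ d1 d2.
have d4 := is_deriveZ (a ^+ k) d3.
apply: is_derive_eq d4 _; rewrite /scaled_polygamma.
by move: (polygamma k.+1) => v; rewrite /GRing.scale/= exprS; ring.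
Qed.

Lemma ln_det_le (R : realType) (m : nat) (A : 'M[R]_m) (t : R) :
  psdmx A -> \det A <> 0 -> 0 < t -> ln (\det A) + m%:R * ln t <= t * \tr A - m%:R.
Proof.
move=> pA dA t0; have /andP[d0 _] := psdmx_det_le pA.
have d_gt0 : 0 < \det A by rewrite lt_neqAle d0 eq_sym andbT; apply/eqP.
have := psdmx_det_le (psdmx_scale (ltW t0) pA).
rewrite detZ mxtraceZ => /andP[_ h].
have td0 : 0 < t ^+ m * \det A by rewrite mulr_gt0 ?exprn_gt0.
rewrite -ler_ln ?posrE ?expR_gt0// expRK lnM ?posrE ?exprn_gt0// lnXn// in h.
by rewrite addrC mulr_natl.
Qed.

(** Taking t = n / a_i with weight a_i turns the traces into n tr M_i. These add up to n tr I = n m,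
    which cancels the sum of the m a_i. Equality holds for M_i = (a_i / n) I. *)
Lemma sum_ln_det_le (R : realType) (m p : nat) (n : R) (a : 'I_p -> R) (M : 'I_p -> 'M[R]_m) :
  (forall i, 0 < a i) -> 0 < n -> \sum_(i < p) a i = n ->
  (forall i, psdmx (M i)) -> (forall i, \det (M i) <> 0) -> \sum_(i < p) M i = 1%:M ->
  \sum_(i < p) a i * ln (\det (M i)) + m%:R * \sum_(i < p) a i * (ln n - ln (a i)) <= 0.
Proof.
move=> a0 n0 an pM dM M1; rewrite mulr_sumr -big_split/=.
apply: (@le_trans _ _ (\sum_(i < p) (n * \tr (M i) - m%:R * a i))).
  apply: ler_sum => i _; have ai := a0 i.
  have t0 : 0 < n / a i by rewrite divr_gt0.
  have := ln_det_le (pM i) (dM i) t0; rewrite ln_div ?posrE// => h.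
  have := ler_wpM2l (ltW ai) h.
  have -> : a i * (n / a i * \tr (M i) - m%:R) = n * \tr (M i) - m%:R * a i.
    by field; rewrite gt_eqF.
  by move=> ih; apply: le_trans ih; rewrite [leRHS]mulrDr (mulrCA (a i)).
by rewrite sumrB -!mulr_sumr -raddf_sum/= M1 an mxtrace1 mulrC subrr.
Qed.

Section log_Q.
Variables (R : realType) (m n p : nat) (a : 'I_p -> R) (M : 'I_p -> 'M[R]_m).
Hypotheses (a_gt0 : forall i, 0 < a i) (n_gt0 : (0 < n)%N)
  (a_sum : \sum_(i < p) a i = n%:R) (M_psd : forall i, psdmx (M i))
  (M_det : forall i, \det (M i) <> 0) (M_sum : \sum_(i < p) M i = 1%:M).

Let shift (j : 'I_m) : R := (m.+1%:R - j%:R) / 2.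

Let pi_factor : R := pi `^ (m%:R * (m%:R - 1) / 4).

Let affine_part (k : nat) (x : R) : R :=
  match k with
  | 0 => ln pi_factor - p%:R * ln pi_factor + x * \sum_(i < p) a i * ln (\det (M i))
  | 1 => \sum_(i < p) a i * ln (\det (M i))
  | _ => 0
  end.

Definition lnQ_deriv (k : nat) (x : R) : R :=
  \sum_(j < m) (scaled_polygamma n%:R (shift j) k x
    - \sum_(i < p) scaled_polygamma (a i) (shift j) k x) + affine_part k x.

Let n0 : (0 : R) < n%:R. Proof. by rewrite ltr0n. Qed.

Let shift_ge1 (j : 'I_m) : 1 <= shift j.
Proof.
rewrite /shift ler_pdivlMr// mul1r lerBrDr -natrD ler_nat addnC.
by rewrite addn2 ltnS ltn_ord.
Qed.

Lemma is_derive_lnQ_deriv (k : nat) (x : R) : 0 < x ->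
  is_derive x 1 (lnQ_deriv k) (lnQ_deriv k.+1 x).
Proof.
move=> x0.
have dA : is_derive x 1 (affine_part k) (affine_part k.+1 x).
  case: k => [|[|k]] /=.
  - apply: is_derive_eq; rewrite /GRing.scale/=; ring.
  - exact: is_derive_cst.
  - exact: is_derive_cst.
have dS (j : 'I_m) : is_derive x 1 (fun t => scaled_polygamma n%:R (shift j) k t
    - \sum_(i < p) scaled_polygamma (a i) (shift j) k t)
    (scaled_polygamma n%:R (shift j) k.+1 x
    - \sum_(i < p) scaled_polygamma (a i) (shift j) k.+1 x).
  have d1 := is_derive_scaled_polygamma k n0 (shift_ge1 j) x0.
  have d2 := @is_derive_bigsum R p (fun i => scaled_polygamma (a i) (shift j) k) _ x
    (fun i => is_derive_scaled_polygamma k (a_gt0 i) (shift_ge1 j) x0).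
  exact: is_deriveB.
exact: (is_deriveD (is_derive_bigsum dS) dA).
Qed.

Let multigamma_gt0_ln (s x : R) : 0 < s -> 0 < x ->
  0 < multigamma m (x * s + m.+1%:R / 2) /\
  ln (multigamma m (x * s + m.+1%:R / 2)) =
    ln pi_factor + \sum_(j < m) scaled_polygamma s (shift j) 0 x.
Proof.
move=> s0 x0; have xs0 : 0 < x * s by rewrite mulr_gt0.
have eqs (j : 'I_m) : x * s + m.+1%:R / 2 - j%:R / 2 = x * s + shift j.
  by rewrite /shift; field.
have g0 (j : 'I_m) : 0 < gamma (x * s + m.+1%:R / 2 - j%:R / 2).
  by rewrite eqs gamma_gt0//; have := shift_ge1 j; lra.
have pi0 : 0 < pi_factor by rewrite powR_gt0// pi_gt0.
split; first by rewrite mulr_gt0// prodr_gt0.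
rewrite /multigamma lnM ?posrE ?prodr_gt0// ln_prod//; congr (_ + _).
by apply: eq_bigr => j _; rewrite eqs /scaled_polygamma expr0 mul1r.
Qed.

Let det_gt0 (i : 'I_p) : 0 < \det (M i).
Proof.
have /andP[d0 _] := psdmx_det_le (M_psd i).
by rewrite lt_neqAle d0 eq_sym andbT; apply/eqP.
Qed.

Lemma Qfun_gt0_ln (x : R) : 0 < x -> 0 < Qfun n a M x /\ ln (Qfun n a M x) = lnQ_deriv 0 x.
Proof.
move=> x0; have [gn lgn] := multigamma_gt0_ln n0 x0.
have ga i : 0 < multigamma m (x * a i + m.+1%:R / 2).
  by case: (multigamma_gt0_ln (a_gt0 i) x0).
have dp i : 0 < \det (M i) `^ (x * a i) by rewrite powR_gt0.
have Pg : 0 < \prod_(i < p) multigamma m (x * a i + m.+1%:R / 2).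
  by apply: prodr_gt0 => i _; exact: ga.
have Pd : 0 < \prod_(i < p) \det (M i) `^ (x * a i).
  by apply: prodr_gt0 => i _; exact: dp.
have lnPg : ln (\prod_(i < p) multigamma m (x * a i + m.+1%:R / 2)) =
    p%:R * ln pi_factor + \sum_(j < m) \sum_(i < p) scaled_polygamma (a i) (shift j) 0 x.
  rewrite (ln_prod ga) exchange_big/=.
  transitivity (\sum_(i < p) (ln pi_factor + \sum_(j < m) scaled_polygamma (a i) (shift j) 0 x)).
    by apply: eq_bigr => i _; case: (multigamma_gt0_ln (a_gt0 i) x0).
  by rewrite big_split sumr_const card_ord mulr_natl.
have lnPd : ln (\prod_(i < p) \det (M i) `^ (x * a i)) =
    x * \sum_(i < p) a i * ln (\det (M i)).
  by rewrite (ln_prod dp) mulr_sumr; apply: eq_bigr => i _; rewrite ln_powR mulrA.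
have Qg := divr_gt0 gn Pg.
split; first exact: mulr_gt0 Qg Pd.
rewrite [LHS](lnM Qg Pd) (ln_div gn Pg) lgn lnPg lnPd /lnQ_deriv sumrB /affine_part.
move: (\sum_(j < m) _) (\sum_(j < m) _) (\sum_(i < p) _) (ln pi_factor) => *; ring.
Qed.

Lemma lnQ_deriv_sign (k : nat) (x : R) : 0 < x -> 0 <= (-1) ^+ k.+1 * lnQ_deriv k.+1 x.
Proof.
move=> x0.
pose H (j : 'I_m) (s : R) := (k == 0)%:R * ln s +
  (-1) ^+ k.+1 * (s ^+ k * polygamma k.+1 (x * s + shift j)).
have HE j s : (-1) ^+ k.+1 * scaled_polygamma s (shift j) k.+1 x =
    s * (H j s - (k == 0)%:R * ln s).
  by rewrite /H /scaled_polygamma (exprS s); move: (polygamma _ _) ((-1) ^+ k.+1) => *; ring.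
have an i : a i <= n%:R.
  by rewrite -a_sum (bigD1 i)//= lerDl sumr_ge0// => l _; exact: ltW.
have Hmono j i : 0 <= a i * (H j n%:R - H j (a i)).
  rewrite mulr_ge0 ?(ltW (a_gt0 i))// subr_ge0.
  exact: polygamma_scale_mono.
(* The cost of the [ln s] put into [H]. It recurs for each of the m shifts, which gives the multiple
   m E that [sum_ln_det_le] absorbs when k = 0. *)
pose E := \sum_(i < p) a i * (ln n%:R - ln (a i)).
have term j : (-1) ^+ k.+1 * (scaled_polygamma n%:R (shift j) k.+1 x
    - \sum_(i < p) scaled_polygamma (a i) (shift j) k.+1 x) =
    \sum_(i < p) a i * (H j n%:R - H j (a i)) - (k == 0)%:R * E.
  rewrite mulrBr HE mulr_sumr; under eq_bigr do rewrite HE.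
  rewrite -a_sum mulr_suml -sumrB /E mulr_sumr -sumrB; apply: eq_bigr => i _.
  by rewrite a_sum; ring.
rewrite /lnQ_deriv mulrDr mulr_sumr; under eq_bigr do rewrite term.
rewrite sumrB sumr_const card_ord -addrA addr_ge0//.
  by apply: sumr_ge0 => j _; apply: sumr_ge0.
have := sum_ln_det_le a_gt0 n0 a_sum M_psd M_det M_sum; rewrite -/E.
case: k {H HE Hmono term} => [|k] /=; last by rewrite mul0r mul0rn oppr0 mulr0 addr0.
by rewrite mul1r expr1 mulN1r -opprD oppr_ge0 mulr_natl addrC.
Qed.

Lemma Qfun_lcm : logarithmically_completely_monotonic `]0, +oo[ (Qfun n a M).
Proof.
have pos x : `]0, +oo[%classic x -> 0 < x :> R by rewrite /= in_itv/= andbT.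
have lnQE x : 0 < x -> ln (Qfun n a M x) = lnQ_deriv 0 x by move=> /Qfun_gt0_ln[].
have QE x : 0 < x -> expR (lnQ_deriv 0 x) = Qfun n a M x.
  by move=> /Qfun_gt0_ln[Q0 <-]; rewrite lnK.
split.
- move=> k x /pos; apply: derivable_derive1n => j.
  (* Q is smooth as the exponential of a smooth function: its logarithmic derivative [lnQ_deriv 1]
     belongs to the tower. *)
  apply: (@nderivable_pos_eq _ _ (fun x => expR (lnQ_deriv 0 x))) => //.
  apply: (@nderivable_pos_log_derivative _ _ _ (lnQ_deriv 1)).
    move=> y y0; apply: is_derive1_comp; last exact: is_derive_lnQ_deriv.
  exact: (nderivable_pos_tower is_derive_lnQ_deriv).
- by move=> x /pos /Qfun_gt0_ln[].
- move=> [//|k] x _ /pos x0.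
  by rewrite (derive1n_tower is_derive_lnQ_deriv lnQE)//; exact: lnQ_deriv_sign.
Qed.

End log_Q.

(** * Singular matrices and families completed by a last member *)

Lemma Qfun_singular (R : realType) (m n p : nat) (a : 'I_p -> R) (M : 'I_p -> 'M[R]_m)
    (i : 'I_p) (x : R) :
  0 < a i -> 0 < x -> \det (M i) = 0 -> Qfun n a M x = 0.
Proof.
move=> a0 x0 d0; rewrite /Qfun [X in _ * X](bigD1 i)//= d0 powR0 ?mul0r ?mulr0//.
by rewrite mulf_neq0 ?gt_eqF.
Qed.

Lemma sum_snoc (V : nmodType) (r : nat) (f : 'I_r -> V) (z : V) :
  \sum_(i < r.+1) snoc f z i = \sum_(i < r) f i + z.
Proof.
rewrite big_ord_recr/= /snoc unlift_none/=; congr (_ + _); apply: eq_bigr => i _.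
rewrite (_ : widen_ord _ i = lift ord_max i) ?liftK//.
by apply: val_inj; rewrite /= /bump leqNgt ltn_ord.
Qed.

Lemma snoc_ind (T : Type) (r : nat) (P : T -> Prop) (f : 'I_r -> T) (z : T) :
  (forall i, P (f i)) -> P z -> forall i, P (snoc f z i).
Proof. by move=> Pf Pz i; rewrite /snoc; case: (unlift ord_max i) => [j|] /=. Qed.

Unset Implicit Arguments.

(* If some M_i is singular, then Q vanishes identically on (0, +oo) and cannot
   be positive, as logarithmic complete monotonicity requires; the conclusion
   therefore distinguishes the two cases. *)
Theorem theorem3p1 (R : realType) (m n r : nat)
    (hm : (0 < m)%N) (hn : (0 < n)%N) (hr : (0 < r)%N)
    (alpha : 'I_r -> R)
    (halpha : forall i : 'I_r, 0 < alpha i)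
    (hsum : \sum_(i < r) alpha i < n%:R)
    (M : 'I_r -> 'M[R]_m)
    (hM : forall i : 'I_r, psdmx (M i))
    (hMlast : psdmx (1%:M - \sum_(i < r) M i)) :
  let a : 'I_r.+1 -> R := snoc alpha (n%:R - \sum_(i < r) alpha i) in
  let N : 'I_r.+1 -> 'M[R]_m := snoc M (1%:M - \sum_(i < r) M i) in
  ((forall i : 'I_r.+1, \det (N i) <> 0) ->
     logarithmically_completely_monotonic `]0, +oo[ (Qfun n a N))
  /\ ((exists i : 'I_r.+1, \det (N i) = 0) ->
     forall x : R, 0 < x -> Qfun n a N x = 0).
Proof.
move=> a N.
have a_gt0 : forall i, 0 < a i by apply: (snoc_ind (P := fun s => 0 < s)) => //; rewrite subr_gt0.
split=> [detN|[i di] x x0]; last exact: Qfun_singular (a_gt0 i) x0 di.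
apply: Qfun_lcm => //.
- by rewrite sum_snoc addrC subrK.
- exact: (snoc_ind (P := @psdmx R m)).
- by rewrite sum_snoc addrC subrK.
Qed.
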